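(* Let $n,J,L,m\in\mathbb{N}$ (positive integers), let $P\in\mathbb{C}[z]^{J\times L}$, $z=(z_1,\dots,z_n)$, be a matrix each of whose nonzero entries is a homogeneous polynomial of degree $m$, let $\lambda\in\mathbb{C}$, and let $\Omega\subset\mathbb{R}^n$ be a nonempty open pointed convex cone. Fix a primary decomposition $M=\bigcap_{\sigma=1}^\mu M_\sigma$ of $M=P^t\mathbb{C}[z]^J\subset\mathbb{C}[z]^L$ with associated prime ideals $\mathfrak{p}_1,\dots,\mathfrak{p}_\mu$ and zero varieties $V_{\mathfrak{p}_\sigma}\subset\mathbb{C}^n$, and an associated family of Noetherian operators $\{\tilde{\mathcal{B}}_{\sigma i}\}$, $1\le\sigma\le\mu$, $1\le i\le\rho_\sigma$, with corresponding $\mathbb{C}^L$-valued operators $\mathcal{B}_{\sigma i}(z,\partial_z)$. Then for all $1\le\sigma\le\mu$, $1\le i\le\rho_\sigma$ and $z\in V_{\mathfrak{p}_\sigma}\cap U_\Omega$, the function $$\Omega\ni x\mapsto u(x)=\mathcal{B}_{\sigma i}(z,\partial_z)\,(-\langle x,z\rangle)^\lambda$$ belongs to $S(\Omega)\cap H_\lambda(\Omega)^L$, i.e. $u\in C^\infty(\Omega)^L$, $P(\partial_x)u=0$ and $x\cdot\nabla_xu=\lambda u$ on $\Omega$. In other words, $S_{\mathcal{B},\lambda}(\Omega)\subset S(\Omega)\cap H_\lambda(\Omega)^L$, where $S_{\mathcal{B},\lambda}(\Omega)$ denotes the set of all such functions.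
   Context: **Conventions.** $\langle x,z\rangle=\sum_kx_kz_k$ (bilinear). Powers $\beta^\lambda=\exp(\lambda\log\beta)$ use the principal branch of the logarithm on $\mathbb{C}\setminus(-\infty,0]$. $\mathcal{O}(U)$ denotes the holomorphic functions on an open set $U\subset\mathbb{C}^n$. Scalar operators act componentwise on vector-valued functions. Compact convex sets are understood to be nonempty. **Cones.** A set $\Omega\subset\mathbb{R}^n$ is a cone if $tx\in\Omega$ for all $x\in\Omega$, $t>0$; it is pointed if $\overline\Omega\cap(-\overline\Omega)=\{0\}$. For nonempty $X\subset\mathbb{R}^n$ set $X^\vee=\{\eta\in\mathbb{R}^n:\langle x,\eta\rangle<0\ \forall x\in\overline X\setminus\{0\}\}$ and $U_X=\{z\in\mathbb{C}^n:\Re z\in X^\vee\}$. **Solution spaces.** $P(\partial_x):C^\infty(\Omega)^L\to C^\infty(\Omega)^J$ is $(P(\partial_x)u)_j=\sum_{l=1}^LP_{jl}(\partial_x)u_l$; $S(\Omega)=\ker P(\partial_x)$. $H_\lambda(\Omega)=\ker(x\cdot\nabla_x-\lambda)\subset C^\infty(\Omega)$. **Primary decomposition.** Each $M_\sigma\subset\mathbb{C}[z]^L$ is a primary submodule with associated prime ideal $\mathfrak{p}_\sigma\subset\mathbb{C}[z]$, and $V_{\mathfrak{p}_\sigma}=\{z\in\mathbb{C}^n:\varphi(z)=0\ \forall\varphi\in\mathfrak{p}_\sigma\}$. **Paley–Wiener weights.** For compact convex $K\subset\mathbb{R}^n$ and $N\in\mathbb{N}_0$: $H_K(w)=\sup_{x\in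 K}\langle x,w\rangle$ for $w\in\mathbb{R}^n$, $w_{K,N}(z)=(1+|z|)^{-N}e^{-H_K(\Re z)}$, and $\operatorname{PW}(K)=\bigcup_{N\in\mathbb{N}_0}\{f\in\mathcal{O}(\mathbb{C}^n):\sup_{z\in\mathbb{C}^n}|f(z)|w_{K,N}(z)<\infty\}$. **Noetherian operators.** An associated family of Noetherian operators (which exists by the classical Ehrenpreis–Palamodov theory, as presented in Hörmander's book An Introduction to Complex Analysis in Several Variables) is a finite family of differential operators with polynomial coefficients $$\tilde{\mathcal{B}}_{\sigma i}(z,\partial_z)f=\sum_{|\alpha|\le A}\sum_{l=1}^La^l_{\sigma i,\alpha}(z)\,\partial_z^\alpha f^l,\qquad a_{\sigma i,\alpha}\in\mathbb{C}[z]^L,$$ acting on $\mathbb{C}^L$-valued holomorphic $f=(f^1,\dots,f^L)$, such that: (N1) for every domain of holomorphy $U\subset\mathbb{C}^n$ and every $f\in\mathcal{O}(U)^L$: $f\in P^t\mathcal{O}(U)^J$ if and only if for all $\sigma$ and all $i$ one has $\tilde{\mathcal{B}}_{\sigma i}(z,\partial_z)f(z)=0$ for all $z\in V_{\mathfrak{p}_\sigma}\cap U$; (N2) if $f\in\mathcal{O}(\mathbb{C}^n)^L$ and there are a compact convex $K\subset\mathbb{R}^n$ and $N\in\mathbb{N}_0$ with $\max_{\sigma,i}\sup_{z\in V_{\mathfrak{p}_\sigma}}|\tilde{\mathcal{B}}_{\sigma i}(z,\partial_z)f(z)|\,w_{K,N}(z)<\infty$, then $f\in\operatorname{PW}(K)^L+P^t\mathcal{O}(\mathbb{C}^n)^J$.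 The corresponding $\mathbb{C}^L$-valued operators, acting on scalar holomorphic functions $f$, are $\mathcal{B}_{\sigma i}(z,\partial_z)f=\sum_{|\alpha|\le A}a_{\sigma i,\alpha}(z)\,\partial_z^\alpha f$. Here they act on the function $z\mapsto(-\langle x,z\rangle)^\lambda$, which is holomorphic on $U_\Omega$ for each $x\in\Omega$ because $\Re(-\langle x,z\rangle)>0$ there. *)

(* Defs.v *)
From mathcomp Require Import all_boot all_order all_algebra.
From mathcomp Require Import complex.
From mathcomp Require Import all_classical all_reals all_analysis.
(* The notations of mpoly clash with those of MathComp-Analysis. *)
From mathcomp Require Import (coercions, canonicals) mpoly.

Set Implicit Arguments.
Unset Strict Implicit.
Unset Printing Implicit Defensive.

Import Order.TTheory GRing.Theory Num.Theory.
Import numFieldNormedType.Exports.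

Local Open Scope classical_set_scope.
Local Open Scope ring_scope.

(* R[i] packed as a numClosedFieldType, so that it inherits the generic
   topology and normed-module structure of number fields over itself. *)
Definition Cx (R : realType) : numClosedFieldType := R[i].

(* C[z_1, ..., z_n] *)
Notation Cpoly R n := (mpoly.mpoly n (Cx R)).

Section ComplexPower.
Variable R : realType.
Implicit Types (z b lam : Cx R).

(* The argument in ]-pi, pi]; it is continuous off ]-oo, 0]. *)
Definition carg z : R :=
  if 0 <= complex.Im z then acos (complex.Re z / Normc.normc z)
  else - acos (complex.Re z / Normc.normc z).

Definition cexp z : Cx R :=
  Complex (expR (complex.Re z) * cos (complex.Im z))
          (expR (complex.Re z) * sin (complex.Im z)).

(* Principal branch; the values on ]-oo, 0] are irrelevant. *)
Definition clog z : Cx R := Complex (ln (Normc.normc z)) (carg z).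

Definition cpow b lam : Cx R := cexp (lam * clog b).

End ComplexPower.

Section Vectors.
Variables (R : realType) (n : nat).
Implicit Types (x w : 'rV[R]_n) (z : 'rV[Cx R]_n).

Definition dotr x w : R := \sum_(k < n) x 0 k * w 0 k.

Definition dotc x z : Cx R := \sum_(k < n) real_complex R (x 0 k) * z 0 k.

Definition rpart z : 'rV[R]_n := \row_k complex.Re (z 0 k).

(* The Euclidean norm (the library's norm on 'rV_n is the sup norm). *)
Definition enorm z : R := Num.sqrt (\sum_(k < n) Normc.normc (z 0 k) ^+ 2).

Definition is_cone (Om : set 'rV[R]_n) : Prop :=
  forall x (t : R), Om x -> 0 < t -> Om (t *: x).

Definition pointed_cone (Om : set 'rV[R]_n) : Prop :=
  closure Om `&` [set - x | x in closure Om] = [set 0].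

(* X^\vee *)
Definition neg_dual (X : set 'rV[R]_n) : set 'rV[R]_n :=
  [set eta | forall x, closure X x -> x != 0 -> dotr x eta < 0].

(* U_X *)
Definition tube (X : set 'rV[R]_n) : set 'rV[Cx R]_n :=
  [set z | neg_dual X (rpart z)].

End Vectors.

Section Derivatives.
Variables (R : realType) (n : nat).

(* The composite of the D k ^ (al k), for operators D k on functions T -> C. *)
Definition multi_partial (T C : Type) (D : 'I_n -> (T -> C) -> T -> C)
    (al : mpoly.multinom n) (f : T -> C) : T -> C :=
  foldr (fun k g => iter (al k) (D k) g) f (enum 'I_n).

(* Complex partial derivative in z_k. *)
Definition cpartial (k : 'I_n) (f : 'rV[Cx R]_n -> Cx R)
    (z : 'rV[Cx R]_n) : Cx R :=
  'D_(delta_mx 0 k) f z.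

(* Partial derivative in the real variable x_k of a complex-valued function. *)
Definition rpartial (k : 'I_n) (u : 'rV[R]_n -> Cx R)
    (x : 'rV[R]_n) : Cx R :=
  Complex ('D_(delta_mx 0 k) (fun y => complex.Re (u y)) x)
          ('D_(delta_mx 0 k) (fun y => complex.Im (u y)) x).

(* C^oo(Om): all iterated partial derivatives exist and are continuous.
   Functions on Om are represented by total functions whose values outside
   the open set Om are ignored. *)
Definition smooth (Om : set 'rV[R]_n) (u : 'rV[R]_n -> Cx R) : Prop :=
  forall (s : seq 'I_n) (x : 'rV[R]_n), Om x ->
    let v := foldr rpartial u s in
    {for x, continuous v} /\
    forall k : 'I_n,
      derivable (fun y => complex.Re (v y)) x (delta_mx 0 k) /\
      derivable (fun y => complex.Im (v y)) x (delta_mx 0 k).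

(* O(U), for open U: differentiability is over the field of complex numbers. *)
Definition holomorphic (U : set 'rV[Cx R]_n) (f : 'rV[Cx R]_n -> Cx R) : Prop :=
  forall z, U z -> differentiable f z.

(* O(U)^q *)
Definition holomorphic_vec q (U : set 'rV[Cx R]_n)
    (f : 'rV[Cx R]_n -> 'cV[Cx R]_q) : Prop :=
  forall l, holomorphic U (fun z => f z l 0).

(* Hormander, An Introduction to Complex Analysis in Several Variables,
   Definition 2.5.1. *)
Definition domain_of_holomorphy (U : set 'rV[Cx R]_n) : Prop :=
  open U /\
  ~ exists U1 U2 : set 'rV[Cx R]_n,
      [/\ open U1 /\ open U2,
          U1 !=set0 /\ U1 `<=` U2 `&` U,
          connected U2 /\ ~ (U2 `<=` U) &
          forall f, holomorphic U f ->
            exists2 g, holomorphic U2 g & forall z, U1 z -> f z = g z].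

End Derivatives.

Section PaleyWiener.
Variables (R : realType) (n : nat).
Implicit Types (K : set 'rV[R]_n) (N : nat).

(* H_K *)
Definition support_fun K (w : 'rV[R]_n) : R := sup [set dotr x w | x in K].

(* w_{K,N} *)
Definition pw_weight K N (z : 'rV[Cx R]_n) : R :=
  (1 + enorm z) ^- N * expR (- support_fun K (rpart z)).

Definition PW K : set ('rV[Cx R]_n -> Cx R) :=
  [set f | holomorphic setT f /\
    exists N (B : R), forall z, Normc.normc (f z) * pw_weight K N z <= B].

End PaleyWiener.

Section Submodules.
Variables (S : comNzRingType) (L : nat).
Implicit Types N : set 'cV[S]_L.

(* The radical { a | a^k S^L is contained in N for some k }: the associated
   prime ideal when N is primary. *)
Definition assoc_prime N : set S :=
  [set a | exists k, forall h : 'cV[S]_L, N (a ^+ k *: h)].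

Definition primary_submodule N : Prop :=
  [/\ submod_closed [in N], N <> setT &
      forall (a : S) (f : 'cV[S]_L), N (a *: f) -> ~ N f -> assoc_prime N a].

Definition primary_decomposition (M : set 'cV[S]_L) mu
    (Ms : 'I_mu -> set 'cV[S]_L) : Prop :=
  (forall s, primary_submodule (Ms s)) /\ M = \bigcap_s Ms s.

End Submodules.

Section Systems.
Variables (R : realType) (n J L : nat).
Implicit Types (P : 'M[Cpoly R n]_(J, L)) (Om : set 'rV[R]_n).

Definition peval (p : Cpoly R n) (z : 'rV[Cx R]_n) : Cx R :=
  mpoly.meval (fun k => z 0 k) p.

(* V_p *)
Definition zero_variety (p : set (Cpoly R n)) : set 'rV[Cx R]_n :=
  [set z | forall phi, p phi -> peval phi z = 0].

(* p(d/dx) u *)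
Definition pdiff (p : Cpoly R n) (u : 'rV[R]_n -> Cx R) (x : 'rV[R]_n) : Cx R :=
  \sum_(al <- mpoly.msupp p)
    mpoly.mcoeff al p * multi_partial (@rpartial R n) al u x.

(* S(Om) *)
Definition solutions P Om : set ('rV[R]_n -> 'cV[Cx R]_L) :=
  [set u | (forall l, smooth Om (fun x => u x l 0)) /\
    forall x, Om x -> forall j,
      \sum_(l < L) pdiff (P j l) (fun y => u y l 0) x = 0].

(* H_lam(Om) *)
Definition euler_homogeneous (lam : Cx R) Om : set ('rV[R]_n -> Cx R) :=
  [set u | smooth Om u /\
    forall x, Om x ->
      \sum_(k < n) real_complex R (x 0 k) * rpartial k u x = lam * u x].

(* P^t C[z]^J *)
Definition image_submodule P : set 'cV[Cpoly R n]_L :=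
  [set P^T *m g | g in [set: 'cV[Cpoly R n]_J]].

(* z |-> P(z)^t g(z) *)
Definition apply_tr P (g : 'rV[Cx R]_n -> 'cV[Cx R]_J)
    (z : 'rV[Cx R]_n) : 'cV[Cx R]_L :=
  (map_mx (peval^~ z) P)^T *m g z.

(* A C^L-valued operator of order at most A: the family of the coefficients
   a_al, for |al| <= A. *)
Definition noeth_op A := mpoly.bmultinom n A.+1 -> 'cV[Cpoly R n]_L.

(* \tilde B(z, d_z) f (z), for f with values in C^L *)
Definition noeth_tilde A (a : noeth_op A) (f : 'rV[Cx R]_n -> 'cV[Cx R]_L)
    (z : 'rV[Cx R]_n) : Cx R :=
  \sum_(al : mpoly.bmultinom n A.+1) \sum_(l < L)
    peval (a al l 0) z *
    multi_partial (@cpartial R n) al (fun w => f w l 0) z.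

(* B(z, d_z) f (z), for scalar f *)
Definition noeth_vec A (a : noeth_op A) (f : 'rV[Cx R]_n -> Cx R)
    (z : 'rV[Cx R]_n) : 'cV[Cx R]_L :=
  \sum_(al : mpoly.bmultinom n A.+1)
    multi_partial (@cpartial R n) al f z *: map_mx (peval^~ z) (a al).

Section Family.
Variables (P : 'M[Cpoly R n]_(J, L)) (mu : nat).
Variables (Ms : 'I_mu -> set 'cV[Cpoly R n]_L).
Variables (rho : 'I_mu -> nat) (A : nat).
Variable (a : forall s, 'I_(rho s) -> noeth_op A).

(* V_{p_s} *)
Definition assoc_variety (s : 'I_mu) : set 'rV[Cx R]_n :=
  zero_variety (assoc_prime (Ms s)).

Definition noetherian_N1 : Prop :=
  forall (U : set 'rV[Cx R]_n) (f : 'rV[Cx R]_n -> 'cV[Cx R]_L),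
    domain_of_holomorphy U -> holomorphic_vec U f ->
    ((exists2 g, holomorphic_vec U g & forall z, U z -> f z = apply_tr P g z)
     <-> forall s (i : 'I_(rho s)) z, assoc_variety s z -> U z ->
           noeth_tilde (a i) f z = 0).

Definition noetherian_N2 : Prop :=
  forall (f : 'rV[Cx R]_n -> 'cV[Cx R]_L) (K : set 'rV[R]_n) (N : nat),
    holomorphic_vec setT f -> compact K -> convex_set K -> K !=set0 ->
    (exists B : R, forall s (i : 'I_(rho s)) z, assoc_variety s z ->
       Normc.normc (noeth_tilde (a i) f z) * pw_weight K N z <= B) ->
    exists (h : 'rV[Cx R]_n -> 'cV[Cx R]_L) (g : 'rV[Cx R]_n -> 'cV[Cx R]_J),
               [/\ forall l, PW K (fun z => h z l 0),
                   holomorphic_vec setT g &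
                   forall z, f z = h z + apply_tr P g z].

Definition noetherian_operators : Prop := noetherian_N1 /\ noetherian_N2.

(* x |-> B_{s i}(z, d_z) (- <x, z>)^lam *)
Definition noeth_power (lam : Cx R) s (i : 'I_(rho s)) (z : 'rV[Cx R]_n)
    (x : 'rV[R]_n) : 'cV[Cx R]_L :=
  noeth_vec (a i) (fun w => cpow (- dotc x w) lam) z.

(* S_{B,lam}(Om); functions on Om are compared on Om only. *)
Definition noeth_power_set (lam : Cx R) Om : set ('rV[R]_n -> 'cV[Cx R]_L) :=
  [set u | exists s (i : 'I_(rho s)) z,
    [/\ assoc_variety s z, tube Om z &
        forall x, Om x -> u x = noeth_power lam i z x]].

End Family.
End Systems.

(* Main.v *)
Require Import Defs.
From mathcomp Require Import all_boot all_order all_algebra.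
From mathcomp Require Import complex.
From mathcomp Require Import all_classical all_reals all_analysis.
From mathcomp Require Import ring lra.
From mathcomp Require Import (coercions, canonicals) mpoly.
Import Order.TTheory GRing.Theory Num.Theory.
Import numFieldNormedType.Exports.
Local Open Scope classical_set_scope.
Local Open Scope ring_scope.

(** The function u is a finite sum of terms a_al(z) d_w^al psi(<x,w>) at w = z,
    with psi(t) = (-t)^lam. Formally, P(d_x) passes through d_w^al, and since
    each entry p of P is homogeneous of degree m it turns psi(<x,w>) into
    p(w) psi^(m)(<x,w>). Hence the j-th component of P(d_x)u at x is
    tilde-B(z,d_w) f (z) for f(w) = psi^(m)(<x,w>) P(w)^t e_j. This f lies in
    the image of P^t, so property (N1) of Noetherian operators should make it
    vanish at the points of the variety.

    The function f is in general not entire. Instead of applying (N1) on a half-space,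
    which would require this half-space to be a domain of holomorphy and thus
    the identity theorem in several variables, the proof uses that
    tilde-B(z,d_w) f (z) depends only on finitely many derivatives of psi at
    the point t0 = <x,z>. A polynomial with the same derivatives at t0 gives an
    entire f with the same value, and (N1) is applied on C^n, which is trivially
    a domain of holomorphy ([noeth_symbol_annihilates]).

    Both the commutation of derivatives and this replacement of psi are made
    algebraic by symbols: the polynomial q = sum_k q_k(x,w) Y^k stands for the
    function sum_k q_k(x,w) psi_k(<x,w>), where psi_k is the k-th derivative of
    psi. On symbols the partial derivatives are the commuting operators
    d/dx_i + w_i Y and d/dw_i + x_i Y ([symbol_deriv_comm],
    [is_derive_symbol_eval]); d_w^al sends 1 to x^al Y^|al|, and p(d_x) sends 1
    to p(w) Y^m ([xdiff_iterated_wderiv]). A symbol is the same for psi and for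
    its polynomial substitute, and its value at a point involves only the
    finitely many numbers psi_k(t0).

    Smoothness holds because functions given by symbols have partial derivatives
    given by symbols. Homogeneity is the identity
    t psi_(k+1)(t) = (lam - k) psi_k(t) combined with Euler's formula for the
    monomials x^al ([symbol_eval_euler]).

    On the analytic side, the complex derivative of the principal power in the
    right half-plane comes from that of exp at 0 and from the derivative of a
    continuous local inverse ([is_derive_cpow]); real partial derivatives are
    restrictions of complex derivatives along lines ([is_derive_Re_Im]). *)

(** * Topology of the complex plane *)

Section ComplexTopology.
Variable R : realType.
Implicit Types z w : Cx R.

Lemma Cx_normE z : `|z| = real_complex R (Normc.normc z).
Proof. by case: z. Qed.

Lemma normr_Re_le z : `|complex.Re z| <= Normc.normc z.
Proof.
case: z => a b; rewrite /= -[X in X <= _]sqrtr_sqr ler_wsqrtr //.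
by rewrite lerDl sqr_ge0.
Qed.

Lemma normr_Im_le z : `|complex.Im z| <= Normc.normc z.
Proof.
case: z => a b; rewrite /= -[X in X <= _]sqrtr_sqr ler_wsqrtr //.
by rewrite lerDr sqr_ge0.
Qed.

Lemma continuous_real_complex : continuous (real_complex R : R -> Cx R).
Proof.
move=> x; apply/(@cvgrPdist_lt _ (Cx R)) => -[e i]; rewrite ltcE /= => /andP[/eqP -> e0].
near=> y; rewrite -rmorphB Cx_normE /= ltcR expr0n addr0 sqrtr_sqr.
by near: y; apply/nbhs_normP; exists e.
Unshelve. all: by end_near. Qed.

Lemma continuous_Re : continuous (@complex.Re R : Cx R -> R).
Proof.
move=> x; apply/(@cvgrPdist_lt _ _ _ _ (nbhs_filter x)) => e e0; near=> y.
have -> : complex.Re x - complex.Re y = complex.Re (x - y).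
  by case: (x) (y) => a b [].
apply: le_lt_trans (normr_Re_le _) _.
rewrite -ltcR -Cx_normE; near: y.
by apply/nbhs_normP; exists (real_complex R e); rewrite //= ltcR.
Unshelve. all: by end_near. Qed.

Lemma continuous_Im : continuous (@complex.Im R : Cx R -> R).
Proof.
move=> x; apply/(@cvgrPdist_lt _ _ _ _ (nbhs_filter x)) => e e0; near=> y.
have -> : complex.Im x - complex.Im y = complex.Im (x - y).
  by case: (x) (y) => a b [].
apply: le_lt_trans (normr_Im_le _) _.
rewrite -ltcR -Cx_normE; near: y.
by apply/nbhs_normP; exists (real_complex R e); rewrite //= ltcR.
Unshelve. all: by end_near. Qed.

Lemma cvg_Complex (T : Type) (F : set_system T) (FF : Filter F)
    (f : T -> Cx R) (l : Cx R) :
  complex.Re (f t) @[t --> F] --> complex.Re l ->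
  complex.Im (f t) @[t --> F] --> complex.Im l ->
  f t @[t --> F] --> l.
Proof.
move=> fR fI; rewrite [l]complexE.
rewrite (_ : f = fun t => real_complex R (complex.Re (f t)) +
    Complex 0 1 * real_complex R (complex.Im (f t)) :> Cx R); last first.
  by apply/funext => t; rewrite -complexE.
apply: (@cvgD _ (Cx R)); last apply: (@cvgM (Cx R)); first 2 last.
- apply: continuous_cvg fI; exact: continuous_real_complex.
- apply: continuous_cvg fR; exact: continuous_real_complex.
- exact: cvg_cst.
Qed.

End ComplexTopology.

(** * One-variable calculus over a number field *)

Section FieldCalculus.
Variable K : numFieldType.

Lemma is_derive_chain (f g : K -> K) (x df dg : K) :
  is_derive x 1 f df -> is_derive (f x) 1 g dg ->
  is_derive x 1 (g \o f) (dg * df).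
Proof.
move=> [fx <-] [gx <-].
have dfx := (derivable1_diffP f x).1 fx.
have dgx := (derivable1_diffP g (f x)).1 gx.
have dgf := differentiable_comp dfx dgx.
apply: DeriveDef; first exact/derivable1_diffP.
rewrite (deriveE _ dgf) (diff_comp dfx dgx) /= (deriv1E gx) (deriv1E fx) !derive1E.
by rewrite scale1r; exact: mulrC.
Qed.

Lemma is_derive_quotient (f : K -> K) (x d : K) :
  h^-1 * (f (h + x) - f x) @[h --> 0^'] --> d <-> is_derive x 1 f d.
Proof.
have e : (fun h => h^-1 * (f (h + x) - f x)) =
    (fun h => h^-1 *: ((f \o shift x) (h *: 1) - f x)).
  by apply/funext => h; rewrite /= [_%:A]mulr1.
split; rewrite e.
  move=> fd; have dE : 'D_1 f x = d by apply: cvg_lim fd.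
  by apply: DeriveDef => //; apply/cvg_ex; exists d.
by move=> [fx <-].
Qed.

Lemma is_derive_horner (p : {poly K}) (x : K) : is_derive x 1 (horner p) p^`().[x].
Proof.
elim/poly_ind: p => [|p c ih].
  rewrite (_ : horner 0 = cst 0); last by apply/funext => y; rewrite hornerE.
  by apply: is_derive_eq; rewrite deriv0 horner0.
rewrite (_ : horner _ = horner p * id + cst c); last first.
  by apply/funext => y; rewrite hornerMXaddC.
apply: is_derive_eq; rewrite derivMXaddC !hornerE.
by rewrite [_%:A]mulr1 [in RHS]mulrC.
Qed.

(** The classical argument for inverse functions: [E] is not assumed to be
    invertible, it is enough that [L] is a continuous local section of it,
    since then the increment of [L] tends to 0 without vanishing. *)
Lemma is_derive_local_inverse (E L : K -> K) (z d : K) :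
  is_derive (L z) 1 E d -> d != 0 -> {for z, continuous L} ->
  (\forall y \near z, E (L y) = y) -> is_derive z 1 L d^-1.
Proof.
move=> /is_derive_quotient dE d0 cL ELK; apply/is_derive_quotient.
pose k (h : K) : K := L (h + z) - L z.
have k0 : k h @[h --> 0^'] --> (0 : K).
  rewrite -[X in _ --> X](subrr (L z)); apply: cvgB; last exact: cvg_cst.
  exact/continuous_withinNshiftx.
have kE : \forall h \near 0^', h != 0 /\ E (k h + L z) - E (L z) = h.
  near=> h; split; first by near: h; exact: nbhs_dnbhs_neq.
  rewrite /k subrK (nbhs_singleton ELK); apply/eqP; rewrite subr_eq; apply/eqP.
  near: h.
  have cz : (h + z) @[h --> (0 : K)^'] --> z.
    by apply/(@continuous_withinNshiftx _ _ _ id); exact: cvg_id.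
  exact: (cz _ ELK).
have kk : k h @[h --> 0^'] --> 0^'.
  move=> A; rewrite /dnbhs /within /= => nA.
  have kA : \forall h \near 0^', k h != 0 -> A (k h) by exact: (k0 _ nA).
  apply: filterS2 kE kA => h [h0 hE]; apply; apply/eqP => kh0.
  by move: hE; rewrite kh0 add0r subrr => hE; rewrite -hE eqxx in h0.
have : ((k h)^-1 * (E (k h + L z) - E (L z)))^-1 @[h --> 0^'] --> d^-1.
  by apply: cvgV => //; exact: (cvg_comp _ _ kk dE).
apply: cvg_trans; apply: near_eq_cvg; near=> h.
have [h0 ->] : h != 0 /\ E (k h + L z) - E (L z) = h by near: h.
by rewrite invfM invrK mulrC.
Unshelve. all: by end_near. Qed.

End FieldCalculus.

(** * The complex exponential, logarithm and powers *)

Section ComplexLog.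
Variable R : realType.
Implicit Types z w : Cx R.

Lemma cexpD z w : cexp (z + w) = cexp z * cexp w.
Proof.
case: z => a b; case: w => c d; rewrite /cexp /= expRD sinD cosD.
by apply/eqP; rewrite eq_complex /=; apply/andP; split; apply/eqP; ring.
Qed.

Lemma cexp0 : cexp 0 = 1 :> Cx R.
Proof. by rewrite /cexp /= expR0 cos0 sin0 !mul1r. Qed.

Lemma cexp_neq0 z : cexp z != 0.
Proof.
apply/eqP => z0; have := cexpD z (- z); rewrite subrr cexp0 z0 mul0r => /eqP.
by rewrite oner_eq0.
Qed.

Lemma Re_gt0_normc z : 0 < complex.Re z -> 0 < Normc.normc z.
Proof.
case: z => a b /= a0; rewrite sqrtr_gt0; apply: (@lt_le_trans _ _ (a ^+ 2)).
  by rewrite exprn_gt0.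
by rewrite lerDl sqr_ge0.
Qed.

(** The argument is defined by cases on the sign of Im z; in the right
    half-plane these cases merge into a single arcsine, which makes its
    continuity across the positive real axis visible. *)
Lemma carg_asin z : 0 < complex.Re z ->
  carg z = asin (complex.Im z / Normc.normc z) /\
  cos (carg z) = complex.Re z / Normc.normc z.
Proof.
move=> z0; have n0 := Re_gt0_normc _ z0.
have t1 : -1 <= complex.Re z / Normc.normc z <= 1.
  rewrite -ler_norml normrM (gtr0_norm (x := _^-1)) ?invr_gt0 //.
  by rewrite ler_pdivrMr // mul1r normr_Re_le.
have t0 : 0 < complex.Re z / Normc.normc z by rewrite divr_gt0.
have nE : Normc.normc z ^+ 2 = complex.Re z ^+ 2 + complex.Im z ^+ 2.
  by case: (z) => a b /=; rewrite sqr_sqrtr // addr_ge0 ?sqr_ge0.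
have sE : sin (acos (complex.Re z / Normc.normc z)) =
    `|complex.Im z| / Normc.normc z.
  rewrite sin_acos //; have -> : 1 - (complex.Re z / Normc.normc z) ^+ 2 =
      (complex.Im z / Normc.normc z) ^+ 2.
    rewrite !expr_div_n; have -> : complex.Im z ^+ 2 = Normc.normc z ^+ 2 - complex.Re z ^+ 2.
      by rewrite nE addrC addKr.
    have := n0; move: (Normc.normc z) (complex.Re z) => u v u0.
    by field; rewrite gt_eqF.
  by rewrite sqrtr_sqr normrM (gtr0_norm (x := _^-1)) ?invr_gt0.
have cK : cos (acos (complex.Re z / Normc.normc z)) =
    complex.Re z / Normc.normc z by apply: acosK; rewrite in_itv /=.
have api2 : acos (complex.Re z / Normc.normc z) <= pi / 2.
  rewrite leNgt; apply/negP => api.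
  have := @ltr_cos R (pi / 2) (acos (complex.Re z / Normc.normc z)).
  rewrite !in_itv /= acos_ge0 ?acos_lepi // cos_pihalf cK.
  have -> : 0 <= (pi : R) / 2 <= pi by have := pi_ge0 R; lra.
  by move=> /(_ isT isT); rewrite api => /ltW; rewrite leNgt t0.
have a0 := acos_ge0 t1.
rewrite /carg; case: ifPn => [i0|]; split => //.
- rewrite -[LHS]sinK; first by rewrite sE ger0_norm.
  by rewrite in_itv /= api2 andbT; lra.
- rewrite -[LHS]sinK; first by rewrite sinN sE ltr0_norm ?ltNge // mulNr opprK.
  by rewrite in_itv /= lerN2 api2 /=; lra.
- by rewrite cosN.
Qed.

Lemma clogK z : 0 < complex.Re z -> cexp (clog z) = z.
Proof.
move=> z0; have n0 := Re_gt0_normc _ z0; have [aE cE] := carg_asin _ z0.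
rewrite /cexp /= lnK ?posrE // cE aE asinK; last first.
  rewrite in_itv /= -ler_norml normrM (gtr0_norm (x := _^-1)) ?invr_gt0 //.
  by rewrite ler_pdivrMr // mul1r normr_Im_le.
by case: z {z0 aE cE} n0 => a b /= n0; congr Complex; field; lra.
Qed.

End ComplexLog.

Section ComplexDerivative.
Variable R : realType.
Implicit Types z w : Cx R.

Lemma normc_le_Re_Im z :
  Normc.normc z <= `|complex.Re z| + `|complex.Im z|.
Proof.
case: z => a b /=; rewrite -(@ler_pXn2r _ 2) ?nnegrE ?addr_ge0 ?sqrtr_ge0 //.
rewrite sqr_sqrtr ?addr_ge0 ?sqr_ge0 // sqrrD !real_normK ?num_real //.
by rewrite addrAC lerDl mulrn_wge0 // mulr_ge0.
Qed.

(** With exp a = 1 + a e(a), cos b = 1 + b c(b) and sin b = b s(b), where e, c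
    and s are continuous and tend to 1, 0 and 1, the real and imaginary parts of
    (cexp h - 1 - h) are combinations of a and b whose coefficients tend to 0;
    a and b are at most |h|, so the quotient is controlled by [bound]. *)
Lemma cvg_cexp_quotient0 : h^-1 * (cexp h - 1) @[h --> (0 : Cx R)^'] --> (1 : Cx R).
Proof.
have [e [eE eC e0]] := (is_derive1_caratheodory (@expR R) 0 _).1 (is_derive_expR 0).
have [c [cE cC c0]] := (is_derive1_caratheodory (@cos R) 0 _).1 (is_derive_cos 0).
have [s [sE sC s0]] := (is_derive1_caratheodory (@sin R) 0 _).1 (is_derive_sin 0).
pose bound (h : Cx R) : R := `|e (complex.Re h) - 1| +
  expR (complex.Re h) * (`|c (complex.Im h)| + `|s (complex.Im h) - 1|) +
  `|expR (complex.Re h) - 1|.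
have Re0 : complex.Re h @[h --> (0 : Cx R)] --> (0 : R).
  exact: (@continuous_Re R 0).
have Im0 : complex.Im h @[h --> (0 : Cx R)] --> (0 : R).
  exact: (@continuous_Im R 0).
have bound0 : bound h @[h --> (0 : Cx R)] --> (0 : R).
  rewrite [X in _ --> X](_ : 0 = `|e 0 - 1| +
      expR 0 * (`|c 0| + `|s 0 - 1|) + `|expR 0 - 1|); last first.
    by rewrite e0 c0 s0 expR0 cos0 sin0 oppr0 !subrr normr0 !addr0 mulr0 addr0.
  have FF : Filter (nbhs (0 : Cx R)) := nbhs_filter 0.
  apply: (@cvgD _ R); first apply: (@cvgD _ R).
  - apply: (@cvg_norm _ R); apply: (@cvgB _ R); last exact: cvg_cst.
    exact: continuous_cvg eC Re0.
  - apply: (@cvgM R); first exact: continuous_cvg (@continuous_expR R 0) Re0.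
    apply: (@cvgD _ R); apply: (@cvg_norm _ R).
      exact: continuous_cvg cC Im0.
    apply: (@cvgB _ R); last exact: cvg_cst.
    exact: continuous_cvg sC Im0.
  - apply: (@cvg_norm _ R); apply: (@cvgB _ R); last exact: cvg_cst.
    exact: continuous_cvg (@continuous_expR R 0) Re0.
have boundP (h : Cx R) : h != 0 ->
    `|h^-1 * (cexp h - 1) - 1| <= real_complex R (bound h).
  move=> h0; have -> : h^-1 * (cexp h - 1) - 1 = h^-1 * (cexp h - 1 - h).
    by rewrite [RHS]mulrBr mulVf.
  rewrite normrM normfV ler_pdivrMl ?normr_gt0 // !Cx_normE -rmorphM lecR.
  apply: le_trans (normc_le_Re_Im _) _; rewrite /bound.
  have := normr_Re_le _ h; have := normr_Im_le _ h; move: (Normc.normc h).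
  case: h {h0} => a b /= n bn an.
  have aE : expR a = 1 + e a * a by rewrite -(expR0 R) -[a in _ * a]subr0 -eE subrKC.
  have bC : cos b = 1 + c b * b by rewrite -(cos0 R) -[b in _ * b]subr0 -cE subrKC.
  have bS : sin b = s b * b by rewrite -[b in _ * b]subr0 -sE sin0 subr0.
  rewrite bC bS oppr0 !addr0.
  have -> : expR a * (1 + c b * b) - 1 - a = (e a - 1) * a + expR a * c b * b.
    by rewrite mulrDr {1}aE; ring.
  have -> : expR a * (s b * b) - b = expR a * (s b - 1) * b + (expR a - 1) * b.
    by ring.
  apply: le_trans (lerD (ler_normD _ _) (ler_normD _ _)) _.
  rewrite !normrM (ger0_norm (expR_ge0 a)) !mulrDr.
  have E0 := expR_ge0 a.
  have := ler_wpM2l (normr_ge0 (e a - 1)) an.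
  have := ler_wpM2l (mulr_ge0 E0 (normr_ge0 (c b))) bn.
  have := ler_wpM2l (mulr_ge0 E0 (normr_ge0 (s b - 1))) bn.
  have := ler_wpM2l (normr_ge0 (expR a - 1)) bn.
  nra.
apply/cvgrPdist_lt => -[d i]; rewrite ltcE /= => /andP[/eqP -> d0].
near=> h; have h0 : h != 0 by near: h; exact: (@nbhs_dnbhs_neq (Cx R)).
rewrite distrC; apply: le_lt_trans (boundP _ h0) _.
rewrite ltcR; apply: le_lt_trans (ler_norm _) _; near: h.
have bound0' : bound h @[h --> (0 : Cx R)^'] --> (0 : R).
  apply: cvg_trans bound0; apply: cvg_app; exact: cvg_within.
exact: (@cvgr0Pnorm_lt _ R _ _ _ bound).1 bound0' d d0.
Unshelve. all: by end_near. Qed.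

Lemma is_derive_cexp z : is_derive z 1 (@cexp R) (cexp z).
Proof.
apply/is_derive_quotient.
rewrite (_ : (fun h => _) = fun h => cexp z * (h^-1 * (cexp h - 1))); last first.
  by apply/funext => h; rewrite cexpD; ring.
rewrite -[X in _ --> X]mulr1; apply: (@cvgM (Cx R)); first exact: cvg_cst.
exact: cvg_cexp_quotient0.
Qed.
End ComplexDerivative.

Section ComplexPowerDerivative.
Variable R : realType.
Implicit Types z w : Cx R.

Lemma near_Re_gt0 z : 0 < complex.Re z -> \forall w \near z, 0 < complex.Re w.
Proof.
move=> z0; have FF : Filter (nbhs z) := nbhs_filter z.
have := (@cvgr_gt _ _ (nbhs z) FF _ _ (@continuous_Re R z)) 0 z0.
exact.
Qed.

Lemma continuous_normc : continuous (@Normc.normc R : Cx R -> R).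
Proof.
move=> z; have FF : Filter (nbhs z) := nbhs_filter z.
rewrite (_ : @Normc.normc R = fun w : Cx R => Num.sqrt
    (complex.Re w * complex.Re w + complex.Im w * complex.Im w)); last first.
  by apply/funext => -[].
apply: continuous_cvg; first exact: sqrt_continuous.
by apply: (@cvgD _ R); apply: (@cvgM R);
  first [exact: continuous_Re | exact: continuous_Im].
Qed.

Lemma continuous_clog z : 0 < complex.Re z -> {for z, continuous (@clog R)}.
Proof.
move=> z0; have FF : Filter (nbhs z) := nbhs_filter z.
have n0 := Re_gt0_normc _ _ z0.
apply: cvg_Complex.
  apply: (@continuous_comp (Cx R) R R); first exact: continuous_normc.
  exact: continuous_ln.
have cE : \forall w \near z, asin (complex.Im w / Normc.normc w) = carg w.
  by near=> w; rewrite (carg_asin _ _ _).1 //; near: w; exact: near_Re_gt0.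
rewrite /= (carg_asin _ _ z0).1.
apply: cvg_trans; first exact: (near_eq_cvg cE).
apply: (@continuous_cvg _ _ _ (nbhs z) FF (fun w : Cx R => complex.Im w / Normc.normc w)).
  apply: continuous_asin; rewrite -ltr_norml normrM (gtr0_norm (x := _^-1)) ?invr_gt0 //.
  rewrite ltr_pdivrMr // mul1r; case: (z) z0 => a b /= a0.
  rewrite -sqrtr_sqr ltr_sqrt; last first.
    by apply: (@lt_le_trans _ _ (a ^+ 2)); rewrite ?exprn_gt0 ?lerDl ?sqr_ge0.
  by rewrite ltrDr exprn_gt0.
apply: (@cvgM R); first exact: continuous_Im.
apply: (@cvgV R); first by rewrite gt_eqF.
exact: continuous_normc.
Unshelve. all: by end_near. Qed.

Lemma is_derive_clog z : 0 < complex.Re z -> is_derive z 1 (@clog R) z^-1.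
Proof.
move=> z0; have dE := is_derive_cexp R (clog z); rewrite clogK // in dE.
apply: (is_derive_local_inverse _ _ _ _ _ dE).
- by apply/eqP => zE; rewrite zE ltxx in z0.
- exact: continuous_clog.
- have Rz := near_Re_gt0 _ z0.
  by apply: filterS Rz => w; exact: clogK.
Qed.

Lemma is_derive_cpow z (lam : Cx R) : 0 < complex.Re z ->
  is_derive z 1 (fun w => cpow w lam) (lam * cpow z (lam - 1)).
Proof.
move=> z0.
have lz : is_derive z 1 (fun w : Cx R => lam * clog w) (lam * z^-1).
  have := is_derive_clog _ z0 => lz.
  exact: (@is_deriveZ _ (Cx R) (Cx R) _ lam z 1 z^-1 lz).
have := @is_derive_chain (Cx R) _ _ _ _ _ lz (is_derive_cexp _ _) => dz.
apply: is_derive_eq dz _.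
rewrite /cpow mulrBl mul1r cexpD -[X in _ * (lam / X)](clogK _ _ z0).
have -> : cexp (- clog z) = (cexp (clog z))^-1.
  apply: (mulrI (_ : cexp (clog z) \is a GRing.unit)).
    by rewrite unitfE cexp_neq0.
  by rewrite -cexpD subrr cexp0 divff ?cexp_neq0.
by ring.
Qed.

End ComplexPowerDerivative.

(** * Symbols and their derivations *)

Section Symbols.
Variables (K : comNzRingType) (N : nat).
Local Notation Kx := (mpoly.mpoly N K).
Implicit Types (l p : Kx) (q r : {poly Kx}) (i j : 'I_N) (v : 'I_N -> K).

(** The derivation of the polynomial coefficients, which annihilates the symbol
    variable. *)
Definition coef_deriv i q : {poly Kx} := map_poly (mpoly.mderiv i) q.

(** A symbol sum_k q_k Y^k stands for the function
    v |-> sum_k q_k(v) psi_k(l(v)), where psi_(k+1) is the derivative of psi_k.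
    By the chain rule, this is what the i-th partial derivative does to it. *)
Definition symbol_deriv l i q : {poly Kx} :=
  coef_deriv i q + mpoly.mderiv i l *: ('X * q).

(** The values c_k = psi_k(l(v)) are an argument of their own: two sequences of
    functions that agree at l(v) up to the size of the symbol cannot be
    distinguished at v. *)
Definition symbol_eval v (c : nat -> K) q : K :=
  \sum_(k < size q) mpoly.meval v q`_k * c k.

Lemma coef_coef_deriv i q k : (coef_deriv i q)`_k = mpoly.mderiv i q`_k.
Proof. by rewrite coef_map. Qed.

Lemma coef_derivD i : {morph coef_deriv i : q r / q + r}.
Proof. by move=> q r; rewrite /coef_deriv raddfD. Qed.

Lemma coef_derivM i q r :
  coef_deriv i (q * r) = coef_deriv i q * r + q * coef_deriv i r.
Proof.
apply/polyP => k; rewrite coefD !coefM coef_coef_deriv coefM raddf_sum -big_split.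
by apply: eq_bigr => m _; rewrite /= !coef_coef_deriv mpoly.mderivM.
Qed.

Lemma coef_derivX i : coef_deriv i 'X = 0.
Proof.
apply/polyP => k; rewrite coef_coef_deriv (coefX _ k) coef0.
by case: (k == 1%N); rewrite ?raddf0 // -mpoly.mpolyC1 mpoly.mderivC.
Qed.

Lemma coef_derivC i p : coef_deriv i p%:P = (mpoly.mderiv i p)%:P.
Proof.
exact: map_polyC.
Qed.

Lemma coef_deriv1 i : coef_deriv i 1 = 0.
Proof. by rewrite -polyC1 coef_derivC -mpoly.mpolyC1 mpoly.mderivC. Qed.

Lemma coef_derivZ i p q :
  coef_deriv i (p *: q) = mpoly.mderiv i p *: q + p *: coef_deriv i q.
Proof. by rewrite -!mul_polyC coef_derivM coef_derivC. Qed.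

Lemma coef_deriv_comm i j q :
  coef_deriv i (coef_deriv j q) = coef_deriv j (coef_deriv i q).
Proof. by apply/polyP => k; rewrite !coef_coef_deriv mpoly.mderiv_comm. Qed.

(** The operators are d_i + (d_i l) Y, whose commutator is the multiplication by
    (d_i d_j l - d_j d_i l) Y, which vanishes. *)
Lemma symbol_deriv_comm l i j q :
  symbol_deriv l i (symbol_deriv l j q) = symbol_deriv l j (symbol_deriv l i q).
Proof.
rewrite /symbol_deriv !coef_derivD !coef_derivZ !coef_derivM !coef_derivX.
rewrite coef_deriv_comm mpoly.mderiv_comm !mul0r !add0r !mulrDr !scalerDr.
rewrite -!scalerAr !scalerA (mulrC (mpoly.mderiv i l)).
rewrite -!addrA; congr (_ + _); rewrite !addrA; congr (_ + _).
by rewrite addrAC.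
Qed.

Lemma mderivXU i j :
  mpoly.mderiv i (mpoly.mpolyX K (mpoly.mnm1 j)) = (i == j)%:R.
Proof.
rewrite mpoly.mderivX mpoly.mnm1E eq_sym; case: eqP => [->|_].
  have -> : mpoly.mnm_sub (mpoly.mnm1 j) (mpoly.mnm1 j) = @mpoly.mnm0 N.
    by apply/mpoly.mnmP => k; rewrite mpoly.mnmBE subnn mpoly.mnm0E.
  by rewrite scale1r mpoly.mpolyX0.
by rewrite scale0r.
Qed.

Lemma symbol_derivD l i : {morph symbol_deriv l i : q r / q + r}.
Proof.
by move=> q r; rewrite /symbol_deriv coef_derivD mulrDr scalerDr addrACA.
Qed.

Lemma symbol_deriv0 l i : symbol_deriv l i 0 = 0.
Proof. by rewrite /symbol_deriv /coef_deriv raddf0 mulr0 scaler0 addr0. Qed.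

Lemma symbol_derivM l i q r :
  symbol_deriv l i (q * r) = coef_deriv i q * r + q * symbol_deriv l i r.
Proof.
rewrite /symbol_deriv coef_derivM mulrDr addrA; congr (_ + _).
by rewrite -scalerAr mulrCA.
Qed.

Lemma symbol_derivZ l i (c : K) q : symbol_deriv l i (mpoly.mpolyC N c *: q) =
  mpoly.mpolyC N c *: symbol_deriv l i q.
Proof.
by rewrite -!mul_polyC symbol_derivM coef_derivC mpoly.mderivC mul0r add0r.
Qed.

Lemma symbol_eval_wide M v c q : (size q <= M)%N ->
  symbol_eval v c q = \sum_(k < M) mpoly.meval v q`_k * c k.
Proof.
move=> qM; rewrite /symbol_eval (big_ord_widen M (fun k => mpoly.meval v q`_k * c k)) //.
rewrite big_mkcond; apply: eq_bigr => k _; case: ifPn => //.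
by rewrite -leqNgt => qk; rewrite nth_default // raddf0 mul0r.
Qed.

Lemma symbol_evalD v c : {morph symbol_eval v c : q r / q + r}.
Proof.
move=> q r; have := leq_maxl (size q) (size r); have := leq_maxr (size q) (size r).
move: (maxn _ _) (size_polyD q r) => M qrM rM qM.
rewrite !(symbol_eval_wide M) // -big_split; apply: eq_bigr => k _.
by rewrite coefD mpoly.mevalD mulrDl.
Qed.

Lemma symbol_eval0 v c : symbol_eval v c 0 = 0.
Proof. by rewrite /symbol_eval size_poly0 big_ord0. Qed.

Lemma symbol_evalZ v c p q :
  symbol_eval v c (p *: q) = mpoly.meval v p * symbol_eval v c q.
Proof.
rewrite (symbol_eval_wide (size q)) ?size_scale_leq // mulr_sumr.
by apply: eq_bigr => k _; rewrite coefZ mpoly.mevalM mulrA.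
Qed.

Lemma symbol_eval_sum v c (I : Type) (s : seq I) (F : I -> {poly Kx}) :
  symbol_eval v c (\sum_(k <- s) F k) = \sum_(k <- s) symbol_eval v c (F k).
Proof. exact: (big_morph _ (symbol_evalD v c) (symbol_eval0 v c)). Qed.

Lemma symbol_eval_polyX v c p k :
  symbol_eval v c (p *: 'X^k) = mpoly.meval v p * c k.
Proof.
rewrite symbol_evalZ (symbol_eval_wide k.+1) ?size_polyXn //.
rewrite big_ord_recr big1 /= => [|m _].
  by rewrite coefXn eqxx mpoly.meval1 mul1r add0r.
by rewrite coefXn ltn_eqF // raddf0 mul0r.
Qed.

Lemma symbol_eval1 v c : symbol_eval v c 1 = c 0%N.
Proof.
by rewrite -[1]scale1r -(expr0 'X) symbol_eval_polyX mpoly.meval1 mul1r.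
Qed.

Lemma symbol_evalMX v c q :
  symbol_eval v c ('X * q) = symbol_eval v (fun k => c k.+1) q.
Proof.
rewrite (symbol_eval_wide (size q).+1); last first.
  by rewrite mulrC (leq_trans (size_polyMleq _ _)) // size_polyX addn2.
rewrite big_ord_recl coefXM raddf0 mul0r add0r.
by apply: eq_bigr => k _; rewrite coefXM.
Qed.

End Symbols.

Arguments coef_deriv {K N} i q.
Arguments symbol_deriv {K N} l i q.
Arguments symbol_eval {K N} v c q.

Section IteratedOperators.
Variables (n : nat) (E : Type).
Implicit Types (D : 'I_n -> E -> E) (al : mpoly.multinom n).

(** The same iteration as [multi_partial], but over an arbitrary type, so that it
    applies to functions and to symbols alike. *)
Definition iterated D al (u : E) : E :=
  foldr (fun k => iter (al k) (D k)) u (enum 'I_n).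

Lemma iterated_comm D al (F : E -> E) :
  (forall k u, F (D k u) = D k (F u)) ->
  forall u, F (iterated D al u) = iterated D al (F u).
Proof.
move=> FD u; rewrite /iterated; elim: (enum _) => //= k s <-.
by elim: (al k) => //= m IH; rewrite FD IH.
Qed.

Lemma iterated_swap D1 D2 al be :
  (forall j k u, D1 j (D2 k u) = D2 k (D1 j u)) ->
  forall u, iterated D1 al (iterated D2 be u) = iterated D2 be (iterated D1 al u).
Proof.
move=> D12 u; apply: iterated_comm => k w.
by apply/esym; apply: iterated_comm => j w'; rewrite D12.
Qed.

End IteratedOperators.

Arguments iterated {n E} D al u.

(** * Symbols as functions *)

Section SymbolCalculus.
Variables (K : numFieldType) (N : nat).
Local Notation Kx := (mpoly.mpoly N K).
Implicit Types (l p : Kx) (q : {poly Kx}) (i : 'I_N) (psi : nat -> K -> K).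

Lemma mpoly_closed_ind (Q : Kx -> Prop) :
  (forall c, Q (mpoly.mpolyC N c)) ->
  (forall i, Q (mpoly.mpolyX K (mpoly.mnm1 i))) ->
  (forall p r, Q p -> Q r -> Q (p + r)) ->
  (forall p r, Q p -> Q r -> Q (p * r)) ->
  forall p, Q p.
Proof.
move=> QC QX QD QM; apply: mpoly.mpolyind => [|c m p _ _ Qp].
  by rewrite -(mpoly.mpolyC0 N K).
apply: QD Qp; rewrite -mpoly.mul_mpolyC; apply: (QM _ _ (QC c)).
rewrite mpoly.mpolyXE_id; apply: (big_ind Q) => // [|i _].
  by rewrite -mpoly.mpolyC1.
elim: (m i) => [|k IH]; first by rewrite expr0 -mpoly.mpolyC1.
by rewrite exprS; exact: QM.
Qed.

(** Differentiating along curves serves both kinds of partial derivatives: the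
    complex ones in w, and the real ones in x, which are obtained by
    restricting the parameter to the reals. *)
Definition coordinate_curve (e : K -> 'I_N -> K) (x : K) i :=
  forall j, is_derive x 1 (fun h => e h j) (i == j)%:R.

Lemma is_derive_meval e x i p : coordinate_curve e x i ->
  is_derive x 1 (fun h => mpoly.meval (e h) p) (mpoly.meval (e x) (mpoly.mderiv i p)).
Proof.
move=> ei; elim/mpoly_closed_ind: p => [c|j|p r dp dr|p r dp dr].
- rewrite (_ : (fun h => _) = cst c); last first.
    by apply/funext => h; rewrite mpoly.mevalC.
  by apply: is_derive_eq; rewrite mpoly.mderivC mpoly.meval0.
- rewrite (_ : (fun h => _) = fun h => e h j); last first.
    by apply/funext => h; rewrite mpoly.mevalXU.
  apply: is_derive_eq (ei j) _; rewrite mderivXU.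
  by case: (i == j); rewrite ?mpoly.meval0 // mpoly.meval1.
- rewrite (_ : (fun h => _) = (fun h => mpoly.meval (e h) p) +
      (fun h => mpoly.meval (e h) r)); last first.
    by apply/funext => h; rewrite mpoly.mevalD.
  by apply: is_derive_eq (is_deriveD dp dr) _; rewrite raddfD mpoly.mevalD.
- rewrite (_ : (fun h => _) = (fun h => mpoly.meval (e h) p) *
      (fun h => mpoly.meval (e h) r)); last first.
    by apply/funext => h; rewrite mpoly.mevalM.
  apply: is_derive_eq (is_deriveM dp dr) _; rewrite mpoly.mderivM mpoly.mevalD !mpoly.mevalM addrC.
  by congr (_ + _); rewrite [LHS]mulrC.
Qed.

Lemma is_derive_symbol_eval l psi e x i q : coordinate_curve e x i ->
  (forall k, is_derive (mpoly.meval (e x) l) 1 (psi k)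
     (psi k.+1 (mpoly.meval (e x) l))) ->
  is_derive x 1
    (fun h => symbol_eval (e h) (psi^~ (mpoly.meval (e h) l)) q)
    (symbol_eval (e x) (psi^~ (mpoly.meval (e x) l)) (symbol_deriv l i q)).
Proof.
move=> ei dpsi; have dl := is_derive_meval _ _ _ l ei.
pose t := mpoly.meval (e x) l; pose dt := mpoly.meval (e x) (mpoly.mderiv i l).
have dterm (k : 'I_(size q)) :
    is_derive x 1 (fun h => mpoly.meval (e h) q`_k * psi k (mpoly.meval (e h) l))
      (mpoly.meval (e x) (mpoly.mderiv i q`_k) * psi k t +
       dt * (mpoly.meval (e x) q`_k * psi k.+1 t)).
  have dc := is_derive_chain _ _ _ _ _ _ dl (dpsi k).
  apply: is_derive_eq (is_deriveM (is_derive_meval _ _ _ q`_k ei) dc) _.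
  rewrite /GRing.scale /= addrC; congr (_ + _); first exact: mulrC.
  by rewrite [RHS]mulrC -[RHS]mulrA.
have -> : (fun h => symbol_eval (e h) (psi^~ (mpoly.meval (e h) l)) q) =
    \sum_(k < size q) (fun h => mpoly.meval (e h) q`_k *
       psi k (mpoly.meval (e h) l)).
  by apply/funext => h; rewrite fct_sumE.
apply: is_derive_eq (is_derive_sum dterm) _.
rewrite big_split -mulr_sumr /symbol_deriv symbol_evalD symbol_evalZ symbol_evalMX.
rewrite (symbol_eval_wide _ _ (size q)) ?size_map_poly_leq //; last first.
  by apply: size_poly.
congr (_ + _); by apply: eq_bigr => k _; rewrite coef_coef_deriv.
Qed.

Lemma continuous_meval (T : topologicalType) (e : T -> 'I_N -> K) (x : T) p :
  (forall j, {for x, continuous (fun y => e y j)}) ->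
  {for x, continuous (fun y => mpoly.meval (e y) p)}.
Proof.
move=> ce; elim/mpoly_closed_ind: p => [c|j|p r cp cr|p r cp cr].
- rewrite (_ : (fun y => _) = cst c); first exact: cst_continuous.
  by apply/funext => h; rewrite mpoly.mevalC.
- rewrite (_ : (fun h => _) = fun h => e h j); first exact: ce.
  by apply/funext => h; rewrite mpoly.mevalXU.
- rewrite (_ : (fun h => _) = (fun h => mpoly.meval (e h) p) +
      (fun h => mpoly.meval (e h) r)); first exact: continuousD.
  by apply/funext => h; rewrite mpoly.mevalD.
- rewrite (_ : (fun h => _) = (fun h => mpoly.meval (e h) p) *
      (fun h => mpoly.meval (e h) r)); first exact: continuousM.
  by apply/funext => h; rewrite mpoly.mevalM.
Qed.

Lemma continuous_symbol_eval (T : topologicalType) l psi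
    (e : T -> 'I_N -> K) (x : T) q :
  (forall j, {for x, continuous (fun y => e y j)}) ->
  (forall k, {for mpoly.meval (e x) l, continuous (psi k)}) ->
  {for x, continuous (fun y => symbol_eval (e y) (psi^~ (mpoly.meval (e y) l)) q)}.
Proof.
move=> ce cpsi.
rewrite (_ : (fun y => _) =
    \sum_(k < size q) (fun y => mpoly.meval (e y) q`_k *
       psi k (mpoly.meval (e y) l))); last first.
  by apply/funext => h; rewrite fct_sumE.
apply: (big_ind (fun f : T -> K => {for x, continuous f})).
- exact: cst_continuous.
- by move=> f g; exact: continuousD.
- move=> k _; apply: continuousM; first exact: continuous_meval.
  by apply: continuous_comp; [exact: continuous_meval | exact: cpsi].
Qed.

End SymbolCalculus.

(** * Symbols for functions of a pairing *)

Section IteratedSymbolDerivative.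
Variables (K : comNzRingType) (N n : nat).
Local Notation Kx := (mpoly.mpoly N K).
Implicit Types (l b : Kx) (q r : {poly Kx}) (al be : mpoly.multinom n).

Lemma iterated_symbol_derivD l (f : 'I_n -> 'I_N) al :
  {morph iterated (fun k => symbol_deriv l (f k)) al : q r / q + r}.
Proof.
move=> q r; rewrite /iterated; elim: (enum _) => //= k s ->.
by elim: (al k) => //= m ->; rewrite symbol_derivD.
Qed.

Lemma iterated_symbol_deriv0 l (f : 'I_n -> 'I_N) al :
  iterated (fun k => symbol_deriv l (f k)) al 0 = 0.
Proof.
rewrite /iterated; elim: (enum _) => //= k s ->.
by elim: (al k) => //= m ->; rewrite symbol_deriv0.
Qed.

Lemma iterated_symbol_deriv_sum l (f : 'I_n -> 'I_N) al
    (I : Type) (s : seq I) (F : I -> {poly Kx}) :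
  iterated (fun k => symbol_deriv l (f k)) al (\sum_(i <- s) F i) =
  \sum_(i <- s) iterated (fun k => symbol_deriv l (f k)) al (F i).
Proof.
exact: (big_morph _ (iterated_symbol_derivD l f al)
  (iterated_symbol_deriv0 l f al)).
Qed.

Lemma iterated_symbol_derivZ l (f : 'I_n -> 'I_N) al (c : K) q :
  iterated (fun k => symbol_deriv l (f k)) al (mpoly.mpolyC N c *: q) =
  mpoly.mpolyC N c *: iterated (fun k => symbol_deriv l (f k)) al q.
Proof.
by rewrite (iterated_comm _ _ _ _ ( *:%R _)) // => k u; rewrite symbol_derivZ.
Qed.

Lemma coef_derivXn (i : 'I_N) d : coef_deriv i ('X^d : {poly Kx}) = 0.
Proof.
elim: d => [|d IH]; first by rewrite expr0 coef_deriv1.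
by rewrite exprS coef_derivM IH coef_derivX mul0r mulr0 addr0.
Qed.

Lemma symbol_deriv_monomial l i b d :
  symbol_deriv l i (b *: 'X^d) =
  mpoly.mderiv i b *: 'X^d + (mpoly.mderiv i l * b) *: 'X^(d.+1).
Proof.
rewrite /symbol_deriv coef_derivZ coef_derivXn scaler0 addr0.
by rewrite -scalerAr scalerA -exprS.
Qed.

(** When the multipliers d_i l of the operators involved do not depend on the
    variables that are differentiated, each operator acts as a multiplication
    by (d_i l) Y. *)
Lemma iterated_symbol_deriv1 l (f : 'I_n -> 'I_N) al :
  (forall j k, mpoly.mderiv (f j) (mpoly.mderiv (f k) l) = 0) ->
  iterated (fun k => symbol_deriv l (f k)) al 1 =
  (\prod_k mpoly.mderiv (f k) l ^+ al k) *: 'X^(mpoly.mdeg al).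
Proof.
move=> ff0; rewrite mpoly.mdegE /iterated -[index_enum _]enumT.
(* The induction also needs that the coefficient stays killed by the d_(f j). *)
set P := (X in _ = X).
suff: foldr (fun k => iter (al k) (symbol_deriv l (f k))) 1 (enum 'I_n) = P /\
    forall j, mpoly.mderiv (f j) (\prod_(k <- enum 'I_n) mpoly.mderiv (f k) l ^+ al k) = 0.
  by case.
rewrite /P {P}; elim: (enum _) => [|k s [IH1 IH2]].
  rewrite !big_nil scale1r expr0; split => // j.
  by rewrite -mpoly.mpolyC1 mpoly.mderivC.
rewrite !big_cons /= IH1; elim: (al k) => [|m [IH3 IH4]].
  by rewrite expr0 mul1r add0n; split.
split; last first.
  by move=> j; rewrite exprS -mulrA mpoly.mderivM ff0 IH4 mul0r mulr0 addr0.
rewrite [LHS]/= IH3 symbol_deriv_monomial IH4 scale0r add0r mulrA -exprS.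
by rewrite addSn.
Qed.

End IteratedSymbolDerivative.

Section PairingSymbols.
Variables (K : comNzRingType) (n : nat).
Local Notation Kx := (mpoly.mpoly (n + n) K).
Implicit Types (p : mpoly.mpoly n K) (al be : mpoly.multinom n).

(** The first n variables are x, the last n are w. *)
Definition xvar (k : 'I_n) : Kx := mpoly.mpolyX K (mpoly.mnm1 (lshift n k)).
Definition wvar (k : 'I_n) : Kx := mpoly.mpolyX K (mpoly.mnm1 (rshift n k)).

Definition pairing : Kx := \sum_k xvar k * wvar k.

Definition xderiv k : {poly Kx} -> {poly Kx} := symbol_deriv pairing (lshift n k).
Definition wderiv k : {poly Kx} -> {poly Kx} := symbol_deriv pairing (rshift n k).

Definition join_point (x w : 'I_n -> K) (i : 'I_(n + n)) : K :=
  match fintype.split i with inl k => x k | inr k => w k end.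

Lemma join_pointl x w k : join_point x w (lshift n k) = x k.
Proof.
rewrite /join_point; case: splitP => j; first by move=> /= /ord_inj ->.
by move=> /= e; have := ltn_ord k; rewrite e ltnNge leq_addr.
Qed.

Lemma join_pointr x w k : join_point x w (rshift n k) = w k.
Proof.
rewrite /join_point; case: splitP => j /=.
  by move=> e; have := ltn_ord j; rewrite -e ltnNge leq_addr.
by move=> /addnI /ord_inj ->.
Qed.

Lemma mderiv_xvar_pairing k : mpoly.mderiv (lshift n k) pairing = wvar k.
Proof.
rewrite raddf_sum (bigD1 k) //= mpoly.mderivM !mderivXU eqxx mul1r.
rewrite eq_lrshift mulr0 addr0 big1 ?addr0 // => j jk.
by rewrite mpoly.mderivM !mderivXU eq_lrshift eq_lshift eq_sym (negPf jk) mul0r mulr0 addr0.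
Qed.

Lemma mderiv_wvar_pairing k : mpoly.mderiv (rshift n k) pairing = xvar k.
Proof.
rewrite raddf_sum (bigD1 k) //= mpoly.mderivM !mderivXU eqxx mulr1.
rewrite eq_rlshift mul0r add0r big1 ?addr0 // => j jk.
by rewrite mpoly.mderivM !mderivXU eq_rlshift eq_rshift eq_sym (negPf jk) mul0r mulr0 addr0.
Qed.

Lemma iterated_xderiv1 al :
  iterated xderiv al 1 = (\prod_k wvar k ^+ al k) *: 'X^(mpoly.mdeg al).
Proof.
rewrite (iterated_symbol_deriv1 _ _ _ _ (lshift n)).
  by under eq_bigr do rewrite mderiv_xvar_pairing.
by move=> j k; rewrite mderiv_xvar_pairing mderivXU eq_lrshift.
Qed.

Lemma iterated_wderiv1 al :
  iterated wderiv al 1 = (\prod_k xvar k ^+ al k) *: 'X^(mpoly.mdeg al).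
Proof.
rewrite (iterated_symbol_deriv1 _ _ _ _ (@rshift n n)).
  by under eq_bigr do rewrite mderiv_wvar_pairing.
by move=> j k; rewrite mderiv_wvar_pairing mderivXU eq_rlshift.
Qed.

(** Written as the sum that arises from p(d_x) 1, see [xdiff_iterated_wderiv]. *)
Definition in_wvar p : Kx :=
  \sum_(be <- mpoly.msupp p) mpoly.mpolyC _ (mpoly.mcoeff be p) *
    \prod_k wvar k ^+ be k.

Lemma meval_in_wvar x w p : mpoly.meval (join_point x w) (in_wvar p) = mpoly.meval w p.
Proof.
rewrite [RHS]mpoly.mevalE /in_wvar raddf_sum; apply: eq_bigr => be _ /=.
rewrite mpoly.mevalM mpoly.mevalC rmorph_prod /=; congr (_ * _).
by apply: eq_bigr => k _; rewrite rmorphXn /= mpoly.mevalXU join_pointr.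
Qed.

Definition xdiff p (q : {poly Kx}) : {poly Kx} :=
  \sum_(be <- mpoly.msupp p)
    mpoly.mpolyC _ (mpoly.mcoeff be p) *: iterated xderiv be q.

(** The derivatives in x and w commute, and each monomial d_x^be of p turns 1 into
    w^be Y^m: homogeneity is what makes the power of Y the same for all. *)
Lemma xdiff_iterated_wderiv (m : nat) p al :
  (forall be, be \in mpoly.msupp p -> mpoly.mdeg be = m) ->
  xdiff p (iterated wderiv al 1) = iterated wderiv al (in_wvar p *: 'X^m).
Proof.
move=> pm; rewrite /xdiff /in_wvar scaler_suml iterated_symbol_deriv_sum.
rewrite big_seq [RHS]big_seq; apply: eq_bigr => be bep.
rewrite -scalerA -(pm _ bep) -iterated_xderiv1 iterated_symbol_derivZ.
by congr (_ *: _); apply: iterated_swap => j k u; exact: symbol_deriv_comm.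
Qed.

Lemma xdiff_sum p (I : Type) (s : seq I) (F : I -> {poly Kx}) :
  xdiff p (\sum_(i <- s) F i) = \sum_(i <- s) xdiff p (F i).
Proof.
rewrite /xdiff exchange_big; apply: eq_bigr => be _.
by rewrite -scaler_sumr; congr (_ *: _); exact: iterated_symbol_deriv_sum.
Qed.

Lemma xdiffZ p (c : K) q :
  xdiff p (mpoly.mpolyC _ c *: q) = mpoly.mpolyC _ c *: xdiff p q.
Proof.
rewrite /xdiff scaler_sumr; apply: eq_bigr => be _.
rewrite scalerA mulrC -scalerA; congr (_ *: _).
exact: iterated_symbol_derivZ.
Qed.

Lemma xderiv_sum k (I : Type) (s : seq I) (F : I -> {poly Kx}) :
  xderiv k (\sum_(i <- s) F i) = \sum_(i <- s) xderiv k (F i).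
Proof.
exact: (big_morph _ (symbol_derivD _ _ pairing (lshift n k))
  (symbol_deriv0 _ _ pairing (lshift n k))).
Qed.

Lemma xderivZ k (c : K) q :
  xderiv k (mpoly.mpolyC _ c *: q) = mpoly.mpolyC _ c *: xderiv k q.
Proof. exact: symbol_derivZ. Qed.

(** The first term is Euler's formula for the monomial x^al, the second one comes
    from x . d_x <x,w> = <x,w>. *)
Lemma euler_xderiv al d :
  \sum_k xvar k *: xderiv k ((\prod_j xvar j ^+ al j) *: 'X^d) =
  ((mpoly.mdeg al)%:R * \prod_j xvar j ^+ al j) *: 'X^d +
  (pairing * \prod_j xvar j ^+ al j) *: 'X^(d.+1).
Proof.
set b := (\prod_j _).
under eq_bigr do rewrite /xderiv symbol_deriv_monomial scalerDr !scalerA mulrA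
  mderiv_xvar_pairing.
rewrite big_split /= -!scaler_suml -!mulr_suml -/pairing; congr (_ *: _ + _).
rewrite /b mpoly.mdegE; elim/big_rec2: _ => [|k m c _ IH].
  by rewrite mul0r big1 // => k _; rewrite -mpoly.mpolyC1 mpoly.mderivC mulr0.
under eq_bigr do rewrite mpoly.mderivM mulrDr.
rewrite big_split /= natrD mulrDl; congr (_ + _); last first.
  by rewrite mulrCA -IH mulr_sumr; apply: eq_bigr => j _; rewrite mulrCA.
under eq_bigr do rewrite mulrA; rewrite -mulr_suml mulrA; congr (_ * _).
elim: (al k) => [|e IHe].
  by rewrite expr0 mul0r big1 // => j _; rewrite -mpoly.mpolyC1 mpoly.mderivC mulr0.
rewrite exprS; under eq_bigr do rewrite mpoly.mderivM mulrDr [X in _ + X]mulrCA.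
rewrite big_split /= -mulr_sumr IHe mulrCA -exprS.
rewrite (bigD1 k) //= mderivXU eqxx mul1r big1 ?addr0 => [|j jk].
  by rewrite -exprS mulrS mulrDl mul1r.
by rewrite /xvar mderivXU eq_lshift (negPf jk) mul0r mulr0.
Qed.

Lemma meval_pairing (x w : 'I_n -> K) :
  mpoly.meval (join_point x w) pairing = \sum_k x k * w k.
Proof.
rewrite /pairing raddf_sum; apply: eq_bigr => k _ /=.
by rewrite mpoly.mevalM !mpoly.mevalXU join_pointl join_pointr.
Qed.

(** The hypothesis is the first-order equation satisfied by the derivatives of a
    function of degree lam; the |al| from x^al and the lam - |al| from it add up
    to lam. *)
Lemma symbol_eval_euler (lam : K) (c : nat -> K) al (x w : 'I_n -> K) :
  (forall k, (\sum_j x j * w j) * c k.+1 = (lam - k%:R) * c k) ->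
  symbol_eval (join_point x w) c
    (\sum_k xvar k *: xderiv k (iterated wderiv al 1)) =
  lam * symbol_eval (join_point x w) c (iterated wderiv al 1).
Proof.
move=> cE; rewrite iterated_wderiv1 euler_xderiv symbol_evalD.
rewrite !symbol_eval_polyX !mpoly.mevalM meval_pairing rmorph_nat.
by rewrite [X in _ + X]mulrAC cE; ring.
Qed.

End PairingSymbols.

Arguments xvar {K n} k.
Arguments wvar {K n} k.
Arguments xderiv {K n} k q.
Arguments wderiv {K n} k q.
Arguments xdiff {K n} p q.
Arguments in_wvar {K n} p.
Arguments join_point {K n} x w i.
Arguments meval_pairing {K n} x w.

(** * Complex and real partial derivatives of represented functions *)

Section RealRestriction.
Variables (R : realType) (n : nat).

Lemma real_complex_dnbhs0 :
  real_complex R h @[h --> (0 : R)^'] --> (0 : Cx R)^'.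
Proof.
move=> A; rewrite /dnbhs /within /= => nA.
have kA : \forall h \near (0 : R), real_complex R h != 0 -> A (real_complex R h).
  exact: (@continuous_real_complex R 0 _ nA).
apply: filterS kA => h kA h0.
by apply: kA; rewrite (inj_eq (@complexI R) h 0).
Qed.

(** The complex difference quotient of [G] restricted to real increments has real
    and imaginary parts equal to the real difference quotients of those of
    [f]. *)
Lemma is_derive_Re_Im (f : 'rV[R]_n -> Cx R) (G : Cx R -> Cx R) (d : Cx R) (x v : 'rV[R]_n) :
  (forall h : R, f (h *: v + x) = G (real_complex R h)) ->
  is_derive (0 : Cx R) 1 G d ->
  is_derive x v (fun y => complex.Re (f y)) (complex.Re d) /\
  is_derive x v (fun y => complex.Im (f y)) (complex.Im d).
Proof.
move=> fG /is_derive_quotient dG.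
have cG := cvg_comp _ _ real_complex_dnbhs0 dG.
have fx : f x = G 0 by rewrite -[x in LHS](add0r x) -(scale0r v) fG.
have qE (h : R) (part : Cx R -> R) :
    (forall (r : R) w, part (real_complex R r * w) = r * part w) ->
    (forall w w', part (w - w') = part w - part w') ->
    h^-1 *: (part (f (h *: v + x)) - part (f x)) =
    part ((real_complex R h)^-1 * (G (real_complex R h + 0) - G 0)).
  by move=> pZ pB; rewrite fG fx addr0 -fmorphV pZ pB.
have key (part : Cx R -> R) : continuous part ->
    (forall (r : R) w, part (real_complex R r * w) = r * part w) ->
    (forall w w', part (w - w') = part w - part w') ->
    is_derive x v (fun y => part (f y)) (part d).
  move=> cp pZ pB.
  have pc : h^-1 *: (part (f (h *: v + x)) - part (f x)) @[h --> (0 : R)^'] -->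
      part d.
    have := cvg_comp _ _ cG (cp d).
    apply: cvg_trans; apply: near_eq_cvg; apply: nearW => h.
    by rewrite /= -qE.
  have dE : 'D_v (fun y => part (f y)) x = part d by apply: cvg_lim pc.
  by apply: DeriveDef => //; apply/cvg_ex; exists (part d).
split; apply: key.
- exact: continuous_Re.
- by move=> r [a b]; rewrite /= mul0r subr0.
- by move=> [a b] [c e].
- exact: continuous_Im.
- by move=> r [a b]; rewrite /= mul0r addr0.
- by move=> [a b] [c e].
Qed.

End RealRestriction.

Section Representation.
Variables (K : numFieldType) (n : nat).

Lemma iterated_rel (S T : Type) (rel : S -> T -> Prop) (D1 : 'I_n -> S -> S)
    (D2 : 'I_n -> T -> T) al u q :
  (forall k u q, rel u q -> rel (D1 k u) (D2 k q)) ->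
  rel u q -> rel (iterated D1 al u) (iterated D2 al q).
Proof.
move=> relD uq; rewrite /iterated; elim: (enum _) => //= k s IH.
by elim: (al k) => //= m IHm; exact: relD.
Qed.

Definition symbol_fun (psi : nat -> K -> K) (q : {poly mpoly.mpoly (n + n) K})
    (x w : 'I_n -> K) : K :=
  symbol_eval (join_point x w) (psi^~ (\sum_k x k * w k)) q.

(** The direction [v] is a function and not a basis vector because it is used
    with the complexification of a real basis vector. *)
Lemma is_derive_symbol_fun_x psi q (x v w : 'I_n -> K) k :
  (forall j, v j = (k == j)%:R) ->
  (forall m, is_derive (\sum_j x j * w j) 1 (psi m)
     (psi m.+1 (\sum_j x j * w j))) ->
  is_derive (0 : K) 1 (fun h : K => symbol_fun psi q (fun j => h * v j + x j) w)
    (symbol_fun psi (xderiv k q) x w).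
Proof.
move=> vE dpsi; pose e (h : K) := join_point (fun j => h * v j + x j) w.
have e0 : e 0 = join_point x w.
  by rewrite /e; congr join_point; apply/funext => j; rewrite mul0r add0r.
have ce : coordinate_curve _ _ e 0 (lshift n k).
  move=> j; rewrite /e /join_point; case: splitP => i ji.
    have -> : (fun h : K => h * v i + x i) = v i *: id + cst (x i).
      by apply/funext => h; rewrite !fctE; congr (_ + _); exact: mulrC.
    apply: is_derive_eq; rewrite addr0 vE [LHS]mulr1.
    by rewrite (_ : j = lshift n i) ?eq_lshift //; apply: val_inj.
  apply: is_derive_eq (is_derive_cst _ _ _) _.
  by rewrite (_ : j = rshift n i) ?eq_lrshift //; apply: val_inj.
have dp m : is_derive (mpoly.meval (e 0) (pairing K n)) 1 (psi m)
    (psi m.+1 (mpoly.meval (e 0) (pairing K n))).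
  by rewrite e0 meval_pairing; exact: dpsi.
have := is_derive_symbol_eval _ _ _ _ _ _ _ q ce dp.
rewrite e0 meval_pairing; congr (is_derive _ _ _ _).
by apply/funext => h; rewrite /symbol_fun -meval_pairing.
Qed.

Lemma is_derive_symbol_fun_w psi q (x v w : 'I_n -> K) k :
  (forall j, v j = (k == j)%:R) ->
  (forall m, is_derive (\sum_j x j * w j) 1 (psi m)
     (psi m.+1 (\sum_j x j * w j))) ->
  is_derive (0 : K) 1 (fun h : K => symbol_fun psi q x (fun j => h * v j + w j))
    (symbol_fun psi (wderiv k q) x w).
Proof.
move=> vE dpsi; pose e (h : K) := join_point x (fun j => h * v j + w j).
have e0 : e 0 = join_point x w.
  by rewrite /e; congr join_point; apply/funext => j; rewrite mul0r add0r.
have ce : coordinate_curve _ _ e 0 (rshift n k).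
  move=> j; rewrite /e /join_point; case: splitP => i ji.
    apply: is_derive_eq (is_derive_cst _ _ _) _.
    by rewrite (_ : j = lshift n i) ?eq_rlshift //; apply: val_inj.
  have -> : (fun h : K => h * v i + w i) = v i *: id + cst (w i).
    by apply/funext => h; rewrite !fctE; congr (_ + _); exact: mulrC.
  apply: is_derive_eq; rewrite addr0 vE [LHS]mulr1.
  by rewrite (_ : j = rshift n i) ?eq_rshift //; apply: val_inj.
have dp m : is_derive (mpoly.meval (e 0) (pairing K n)) 1 (psi m)
    (psi m.+1 (mpoly.meval (e 0) (pairing K n))).
  by rewrite e0 meval_pairing; exact: dpsi.
have := is_derive_symbol_eval _ _ _ _ _ _ _ q ce dp.
rewrite e0 meval_pairing; congr (is_derive _ _ _ _).
by apply/funext => h; rewrite /symbol_fun -meval_pairing.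
Qed.

Lemma is_derive_line (V : normedModType K) (f : V -> K) (x v : V) d :
  is_derive (0 : K) 1 (fun h => f (h *: v + x)) d -> is_derive x v f d.
Proof.
move=> /is_derive_quotient; under eq_fun do rewrite addr0.
rewrite scale0r add0r => fd.
have dE : 'D_v f x = d by apply: cvg_lim fd.
by apply: DeriveDef => //; apply/cvg_ex; exists d.
Qed.

Lemma continuous_symbol_fun (T : topologicalType) psi q (e f : T -> 'I_n -> K) (x : T) :
  (forall j, {for x, continuous (fun y => e y j)}) ->
  (forall j, {for x, continuous (fun y => f y j)}) ->
  (forall k, {for \sum_j e x j * f x j, continuous (psi k)}) ->
  {for x, continuous (fun y => symbol_fun psi q (e y) (f y))}.
Proof.
move=> ce cf cpsi.
rewrite (_ : (fun y => _) = (fun y => symbol_eval (join_point (e y) (f y))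
   (psi^~ (mpoly.meval (join_point (e y) (f y)) (pairing K n))) q)); last first.
  by apply/funext => y; rewrite /symbol_fun meval_pairing.
apply: continuous_symbol_eval; last by rewrite meval_pairing.
move=> j; rewrite /join_point; case: (fintype.split j) => i; [exact: ce | exact: cf].
Qed.

Definition derivative_chain (D : set K) (psi : nat -> K -> K) : Prop :=
  forall t, D t -> forall k, is_derive t 1 (psi k) (psi k.+1 t).

Lemma derivative_chain_continuous D psi t k :
  derivative_chain D psi -> D t -> {for t, continuous (psi k)}.
Proof.
move=> dpsi Dt; have [dk _] := dpsi t Dt k.
by apply/differentiable_continuous/derivable1_diffP.
Qed.

Section Frequency.
Variables (D : set K) (psi : nat -> K -> K) (x : 'I_n -> K).
Hypotheses (D_open : open D) (dpsi : derivative_chain D psi).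

(** Only frequencies [w] with <x,w> in [D] count, since [psi] is a chain of
    derivatives on [D] alone: a half-plane for powers, the plane for
    polynomials. *)
Definition represents_w (f : 'rV[K]_n -> K) q : Prop :=
  forall w : 'rV[K]_n, D (\sum_j x j * w 0 j) -> f w = symbol_fun psi q x (w 0).

Lemma near_D_w (w : 'rV[K]_n) : D (\sum_j x j * w 0 j) ->
  \forall y \near w, D (\sum_j x j * (y : 'rV[K]_n) 0 j).
Proof.
move=> Dw; have cl : {for w, continuous (fun y : 'rV[K]_n => \sum_j x j * y 0 j)}.
  have -> : (fun y : 'rV[K]_n => \sum_j x j * y 0 j) =
      (fun y => mpoly.meval (join_point x (y 0)) (pairing K n)).
    by apply/funext => y; rewrite meval_pairing.
  apply: continuous_meval => j; rewrite /join_point.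
  case: (fintype.split j) => i; first exact: cst_continuous.
  exact: coord_continuous.
by apply: cl; apply: open_nbhs_nbhs; split.
Qed.

Lemma represents_w_derive f q k : represents_w f q ->
  represents_w (fun w => 'D_(delta_mx 0 k) f w) (wderiv k q).
Proof.
move=> fq w Dw; rewrite (@near_eq_derive _ _ _ _ (fun y : 'rV[K]_n => symbol_fun psi q x (y 0))).
  suff H : is_derive w (delta_mx 0 k) (fun y : 'rV[K]_n => symbol_fun psi q x (y 0))
    (symbol_fun psi (wderiv k q) x (w 0)) by rewrite derive_val.
  apply: is_derive_line.
  have vE j : (delta_mx 0 k : 'rV[K]_n) 0 j = (k == j)%:R.
    by rewrite mxE eqxx eq_sym.
  have := is_derive_symbol_fun_w psi q x _ _ k vE (dpsi _ Dw).
  congr (is_derive _ _ _ _); apply/funext => h; congr symbol_fun.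
  by apply/funext => j; rewrite !mxE.
by apply: filterS (near_D_w _ Dw) => y; exact: fq.
Qed.

Lemma represents_w_iterated f q al : represents_w f q ->
  represents_w (iterated (fun k f w => 'D_(delta_mx 0 k) f w) al f)
    (iterated wderiv al q).
Proof. by apply: iterated_rel => k u r; exact: represents_w_derive. Qed.

End Frequency.

End Representation.

Arguments symbol_fun {K n} psi q x w.
Arguments derivative_chain {K} D psi.

Section Space.
Variables (R : realType) (n : nat).
Variables (D : set (Cx R)) (psi : nat -> Cx R -> Cx R) (Om : set 'rV[R]_n).
Variable (z : 'rV[Cx R]_n).
Hypotheses (dpsi : derivative_chain D psi) (Om_open : open Om).
Hypothesis D_Om : forall x, Om x -> D (dotc x z).

Definition cvec (x : 'rV[R]_n) : 'I_n -> Cx R := fun k => real_complex R (x 0 k).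

Definition represents (u : 'rV[R]_n -> Cx R) q : Prop :=
  forall x, Om x -> u x = symbol_fun psi q (cvec x) (z 0).

Lemma represents_is_derive u q k x : represents u q -> Om x ->
  is_derive x (delta_mx 0 k) (fun y => complex.Re (u y))
    (complex.Re (symbol_fun psi (xderiv k q) (cvec x) (z 0))) /\
  is_derive x (delta_mx 0 k) (fun y => complex.Im (u y))
    (complex.Im (symbol_fun psi (xderiv k q) (cvec x) (z 0))).
Proof.
move=> uq Omx.
have vE j : cvec (delta_mx 0 k) j = (k == j)%:R.
  by rewrite /cvec mxE eqxx eq_sym /=; case: eqP; rewrite ?rmorph1 ?rmorph0.
have dG := is_derive_symbol_fun_x _ _ psi q (cvec x) _ (z 0) k vE
  (dpsi _ (D_Om _ Omx)).
have [] := is_derive_Re_Im _ _ (fun y => symbol_fun psi q (cvec y) (z 0))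
   _ _ x (delta_mx 0 k) _ dG.
  move=> h; congr symbol_fun; apply/funext => j.
  by rewrite /cvec !mxE rmorphD rmorphM.
have near_eq (part : Cx R -> R) : \near x,
    part (symbol_fun psi q (cvec x) (z 0)) = part (u x).
  by near=> y; rewrite uq //; near: y; exact: open_nbhs_nbhs.
move=> dR dI; split.
  exact: near_eq_is_derive (near_eq (@complex.Re R)) dR.
exact: near_eq_is_derive (near_eq (@complex.Im R)) dI.
Unshelve. all: by end_near. Qed.

Lemma represents_rpartial u q k : represents u q ->
  represents (rpartial k u) (xderiv k q).
Proof.
move=> uq x Omx; have [dR dI] := represents_is_derive _ _ k _ uq Omx.
rewrite /rpartial (@derive_val _ _ _ _ _ _ _ dR) (@derive_val _ _ _ _ _ _ _ dI).
by case: symbol_fun.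
Qed.

(** All iterated partial derivatives of a represented function are represented,
    hence differentiable and continuous. *)
Lemma represents_smooth u q : represents u q -> smooth Om u.
Proof.
move=> uq s x Omx; rewrite /=.
have [r ur] : exists r, represents (foldr (@rpartial R n) u s) r.
  elim: s => [|k s [r IH]]; first by exists q.
  by exists (xderiv k r); exact: represents_rpartial.
move: (foldr _ _ _) ur => v vr; split; last first.
  move=> k; have [[dR _] [dI _]] := represents_is_derive _ _ k _ vr Omx.
  split; [exact: dR | exact: dI].
have FF : Filter (nbhs x) := nbhs_filter x.
have vE : \near x, symbol_fun psi r (cvec x) (z 0) = v x.
  by near=> y; rewrite vr //; near: y; exact: open_nbhs_nbhs.
have cv : symbol_fun psi r (cvec y) (z 0) @[y --> x] -->
    symbol_fun psi r (cvec x) (z 0).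
  apply: continuous_symbol_fun => [j|j|k].
  - apply: continuous_comp; first exact: coord_continuous.
    exact: continuous_real_complex.
  - exact: cst_continuous.
  - exact: derivative_chain_continuous dpsi (D_Om _ Omx).
rewrite -(vr _ Omx) in cv.
exact: cvg_trans (near_eq_cvg vE) cv.
Unshelve. all: by end_near. Qed.

Lemma symbol_fun_sum (I : Type) (s : seq I)
    (F : I -> {poly mpoly.mpoly (n + n) (Cx R)}) x w :
  symbol_fun psi (\sum_(i <- s) F i) x w =
  \sum_(i <- s) symbol_fun psi (F i) x w.
Proof. exact: symbol_eval_sum. Qed.

Lemma represents_pdiff u q p : represents u q ->
  represents (pdiff p u) (xdiff p q).
Proof.
move=> uq x Omx; rewrite /pdiff /xdiff symbol_fun_sum.
apply: eq_bigr => be _; rewrite /symbol_fun symbol_evalZ mpoly.mevalC; congr (_ * _).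
suff H : represents (iterated (@rpartial R n) be u) (iterated xderiv be q).
  exact: (H x Omx).
by apply: iterated_rel uq => k v r; exact: represents_rpartial.
Qed.

Lemma represents_euler (lam : Cx R) u q : represents u q ->
  (forall x, Om x ->
     symbol_fun psi (\sum_k xvar k *: xderiv k q) (cvec x) (z 0) =
     lam * symbol_fun psi q (cvec x) (z 0)) ->
  euler_homogeneous lam Om u.
Proof.
move=> uq eq_q; split; first exact: represents_smooth uq.
move=> x Omx; rewrite (uq _ Omx) -(eq_q _ Omx) symbol_fun_sum.
apply: eq_bigr => k _; rewrite (represents_rpartial _ _ k uq _ Omx).
rewrite /symbol_fun symbol_evalZ mpoly.mevalXU join_pointl //.
Qed.

End Space.

(** * Powers and their polynomial jets *)

Section Chains.
Variable R : realType.

Definition falling (lam : Cx R) k : Cx R := \prod_(i < k) (lam - i%:R).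

(** The k-th derivative of t |-> (-t)^lam, for Re t < 0. *)
Definition power_chain (lam : Cx R) k (t : Cx R) : Cx R :=
  (-1) ^+ k * falling lam k * cpow (- t) (lam - k%:R).

Lemma power_chain0 lam t : power_chain lam 0 t = cpow (- t) lam.
Proof. by rewrite /power_chain /falling big_ord0 expr0 !mul1r subr0. Qed.

Lemma power_chainP lam :
  derivative_chain [set t : Cx R | complex.Re t < 0] (power_chain lam).
Proof.
move=> t /= t0 k.
have t0' : 0 < complex.Re (- t) by case: (t) t0 => a b /=; rewrite oppr_gt0.
have dN : is_derive t 1 (fun y : Cx R => - y) (-1).
  exact: is_deriveN (is_derive_id t 1).
have dc := is_derive_chain _ _ _ _ _ _ dN (is_derive_cpow _ _ (lam - k%:R) t0').
have := @is_deriveZ (Cx R) (Cx R) (Cx R) _ ((-1) ^+ k * falling lam k) t 1 _ dc => dz.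
apply: is_derive_eq dz _.
rewrite /power_chain /falling big_ord_recr exprS /= -natr1 opprD addrA.
rewrite /GRing.scale /=; ring.
Qed.

Lemma power_chain_euler lam k t : complex.Re t < 0 ->
  t * power_chain lam k.+1 t = (lam - k%:R) * power_chain lam k t.
Proof.
move=> t0.
have t0' : 0 < complex.Re (- t) by case: (t) t0 => a b /=; rewrite oppr_gt0.
have E : cpow (- t) (lam - k%:R) = - t * cpow (- t) (lam - k.+1%:R).
  rewrite -[X in X * _](clogK _ _ t0') /cpow -cexpD; congr cexp.
  by rewrite -natr1; ring.
by rewrite /power_chain E /falling big_ord_recr exprS /=; ring.
Qed.

End Chains.

Section PolynomialChain.
Variable K : numFieldType.

(** [T] is centred at [t0], so that prescribing the jet at [t0] amounts to
    prescribing the coefficients of [T]. *)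
Definition poly_chain (T : {poly K}) (t0 : K) k (t : K) : K := (T^`(k)).[t - t0].

Lemma poly_chainP T t0 : derivative_chain setT (poly_chain T t0).
Proof.
move=> t _ k.
have dB : is_derive t 1 (fun y : K => y - t0) 1.
  by apply: is_derive_eq; rewrite oppr0 addr0.
have := is_derive_chain _ _ _ _ _ _ dB (is_derive_horner _ T^`(k) (t - t0)) => dc.
by apply: is_derive_eq dc _; rewrite mulr1 /poly_chain derivnS.
Qed.

Lemma poly_chain_jet M (c : nat -> K) t0 :
  exists T, forall k, (k < M)%N -> poly_chain T t0 k t0 = c k.
Proof.
exists (\poly_(i < M) (c i / i`!%:R)) => k kM.
rewrite /poly_chain subrr horner_coef0 coef_derivn coef_poly addn0 kM.
by rewrite ffactnn -[LHS]mulr_natr divfK // pnatr_eq0 -lt0n fact_gt0.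
Qed.

End PolynomialChain.

Arguments power_chain {R} lam k t.
Arguments poly_chain {K} T t0 k t.
Arguments represents {R n} psi Om z u q.
Arguments represents_w {K n} D psi x f q.
Arguments cvec {R n} x k.

Section EntireFunctions.
Variables (K : numFieldType) (n : nat).

Lemma differentiable_meval (p : mpoly.mpoly n K) (w : 'rV[K]_n) :
  differentiable (fun y : 'rV[K]_n => mpoly.meval (y 0) p) w.
Proof.
elim/mpoly_closed_ind: p => [c|j|p r dp dr|p r dp dr].
- rewrite (_ : (fun y => _) = cst c); first exact: differentiable_cst.
  by apply/funext => y; rewrite mpoly.mevalC.
- rewrite (_ : (fun y => _) = fun y : 'rV[K]_n => y 0 j).
    exact: differentiable_coord.
  by apply/funext => y; rewrite mpoly.mevalXU.
- rewrite (_ : (fun y => _) = (fun y : 'rV[K]_n => mpoly.meval (y 0) p) +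
      (fun y : 'rV[K]_n => mpoly.meval (y 0) r)); first exact: differentiableD.
  by apply/funext => y; rewrite mpoly.mevalD.
- rewrite (_ : (fun y => _) = (fun y : 'rV[K]_n => mpoly.meval (y 0) p) *
      (fun y : 'rV[K]_n => mpoly.meval (y 0) r)); first exact: differentiableM.
  by apply/funext => y; rewrite mpoly.mevalM.
Qed.

Lemma differentiable_dot (x : 'I_n -> K) (w : 'rV[K]_n) :
  differentiable (fun y : 'rV[K]_n => \sum_k x k * y 0 k) w.
Proof.
have -> : (fun y : 'rV[K]_n => \sum_k x k * y 0 k) =
   \sum_k (x k *: (fun y : 'rV[K]_n => y 0 k)).
  by apply/funext => y; rewrite fct_sumE.
by apply: differentiable_sum => k; apply: differentiableZ; exact: differentiable_coord.
Qed.

Lemma differentiable_poly_chain T t0 k (x : 'I_n -> K) (w : 'rV[K]_n) :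
  differentiable (fun y : 'rV[K]_n => poly_chain T t0 k (\sum_k x k * y 0 k)) w.
Proof.
apply: (@differentiable_comp _ _ _ _ (fun y : 'rV[K]_n => \sum_k x k * y 0 k)
  (poly_chain T t0 k)); first exact: differentiable_dot.
apply/derivable1_diffP.
by have [dk _] := poly_chainP _ T t0 _ (I : setT (\sum_k x k * w 0 k)) k.
Qed.

End EntireFunctions.

(** * Noetherian operators *)

Section Annihilation.
Variables (R : realType) (n J L m : nat).
Variable P : 'M[Cpoly R n]_(J, L).
Hypothesis P_homog : forall j l be, be \in mpoly.msupp (P j l) -> mpoly.mdeg be = m.

Section Operator.
Variables (A : nat) (a : noeth_op R n L A) (z : 'rV[Cx R]_n).

(** The coefficients of the operator are evaluated at [z] once and for all: only
    its value at [z] matters, and as constants they commute with the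
    derivatives in x. *)
Definition noeth_symbol l (q : {poly mpoly.mpoly (n + n) (Cx R)}) :=
  \sum_(al : mpoly.bmultinom n A.+1)
    mpoly.mpolyC (n + n) (peval (a al l 0) z) *: iterated wderiv al q.

Lemma xdiff_noeth_symbol j l :
  xdiff (P j l) (noeth_symbol l 1) = noeth_symbol l (in_wvar (P j l) *: 'X^m).
Proof.
rewrite /noeth_symbol xdiff_sum; apply: eq_bigr => al _.
by rewrite xdiffZ (xdiff_iterated_wderiv _ _ _ _ _ (P_homog j l)).
Qed.

Lemma noeth_symbol_eval psi l q (x : 'I_n -> Cx R) D f :
  open D -> derivative_chain D psi -> D (\sum_k x k * z 0 k) ->
  represents_w D psi x f q ->
  symbol_fun psi (noeth_symbol l q) x (z 0) =
  \sum_(al : mpoly.bmultinom n A.+1)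
    peval (a al l 0) z * multi_partial (@cpartial R n) al f z.
Proof.
move=> oD dpsi Dz fq; rewrite /noeth_symbol symbol_fun_sum; apply: eq_bigr => al _.
rewrite /symbol_fun symbol_evalZ mpoly.mevalC; congr (_ * _).
exact/esym/(represents_w_iterated _ _ _ _ _ oD dpsi _ _ al fq z Dz).
Qed.

End Operator.

Section Family.
Variables (mu : nat) (Ms : 'I_mu -> set 'cV[Cpoly R n]_L).
Variables (rho : 'I_mu -> nat) (A : nat).
Variable (a : forall s : 'I_mu, 'I_(rho s) -> noeth_op R n L A).
Hypothesis a_N1 : noetherian_N1 P Ms a.

Lemma domain_of_holomorphy_setT : @domain_of_holomorphy R n setT.
Proof.
split; first exact: openT.
by move=> [U1 [U2 [_ _ [_ nU] _]]]; apply: nU.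
Qed.

(** The values [c] are arbitrary. Up to the size of the symbol they are the
    derivatives at t0 = <x,z> of a polynomial, and for it the sum is
    tilde-B(z,d_w) applied to an entire element of the image of P^t, to which
    (N1) applies on the whole space. *)
Lemma noeth_symbol_annihilates s (i : 'I_(rho s)) z x j (c : nat -> Cx R) :
  assoc_variety Ms s z ->
  \sum_l symbol_eval (join_point x (z 0)) c
    (noeth_symbol A (a s i) z l (in_wvar (P j l) *: 'X^m)) = 0.
Proof.
move=> Vz; rewrite -symbol_eval_sum; set Q := (\sum_l _).
pose t0 := \sum_k x k * z 0 k.
have [T Tc] := poly_chain_jet _ (size Q) c t0.
have -> : symbol_eval (join_point x (z 0)) c Q =
    symbol_fun (poly_chain T t0) Q x (z 0).
  by apply: eq_bigr => k _; rewrite Tc.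
pose g (w : 'rV[Cx R]_n) : 'cV[Cx R]_J :=
  poly_chain T t0 m (\sum_k x k * w 0 k) *: delta_mx j 0.
have fE w l : apply_tr P g w l 0 =
    peval (P j l) w * poly_chain T t0 m (\sum_k x k * w 0 k).
  rewrite /apply_tr mxE (bigD1 j) //= !mxE !eqxx mulr1 [X in _ + X]big1 ?addr0 // => k kj.
  by rewrite !mxE (negPf kj) mulr0 mulr0.
have dP w l : differentiable (fun y => apply_tr P g y l 0) w.
  rewrite (_ : (fun y => _) = (fun y : 'rV[Cx R]_n => mpoly.meval (y 0) (P j l)) *
      (fun y : 'rV[Cx R]_n => poly_chain T t0 m (\sum_k x k * y 0 k))).
    apply: differentiableM; first exact: differentiable_meval.
    exact: differentiable_poly_chain.
  by apply/funext => y; rewrite fE.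
have dg w l : differentiable (fun y => g y l 0) w.
  rewrite (_ : (fun y => _) = (delta_mx j (0 : 'I_1) l 0 : Cx R) *:
      (fun y : 'rV[Cx R]_n => poly_chain T t0 m (\sum_k x k * y 0 k))).
    by apply: differentiableZ; exact: differentiable_poly_chain.
  by apply/funext => y; rewrite /g mxE [LHS]mulrC.
have [+ _] := a_N1 setT (apply_tr P g) domain_of_holomorphy_setT (fun l w _ => dP w l).
move=> /(_ _ s i z Vz I) <-; last by exists g => // l w _; exact: dg.
rewrite /Q symbol_fun_sum /noeth_tilde exchange_big; apply: eq_bigr => l _ /=.
apply: (noeth_symbol_eval A _ _ _ _ _ _ setT) => //; first exact: openT.
  exact: poly_chainP.
move=> w _; rewrite fE /symbol_fun symbol_eval_polyX.
by rewrite meval_in_wvar.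
Qed.

Lemma open_Re_lt0 : open [set t : Cx R | complex.Re t < 0].
Proof.
have := @open_comp (Cx R) R (@complex.Re R) [set r | r < 0].
by apply; [move=> t _; exact: continuous_Re | exact: open_lt].
Qed.

Variables (lam : Cx R) (Om : set 'rV[R]_n) (z : 'rV[Cx R]_n).
Hypothesis Om_open : open Om.
Hypothesis Re_lt0 : forall x, Om x -> complex.Re (dotc x z) < 0.
Variables (s : 'I_mu) (i : 'I_(rho s)).

Lemma represents_noeth_power u l :
  (forall x, Om x -> u x = noeth_power a lam i z x l 0) ->
  represents (power_chain lam) Om z u (noeth_symbol A (a s i) z l 1).
Proof.
move=> uE x Omx; rewrite uE // /noeth_power /noeth_vec summxE.
rewrite (noeth_symbol_eval A _ _ _ _ _ _ _ (fun w => cpow (- dotc x w) lam)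
  open_Re_lt0 (power_chainP R lam)).
- by apply: eq_bigr => al _; rewrite !mxE mulrC.
- exact: Re_lt0.
- move=> w _; by rewrite /symbol_fun symbol_eval1 power_chain0.
Qed.

(** Stated for any [u] that agrees with the given function on [Om], since
    elements of the solution spaces only matter there. *)
Lemma noeth_power_solution (u : 'rV[R]_n -> 'cV[Cx R]_L) :
  assoc_variety Ms s z ->
  (forall x, Om x -> u x = noeth_power a lam i z x) ->
  solutions P Om u /\
  forall l, euler_homogeneous lam Om (fun x => u x l 0).
Proof.
move=> Vz uE.
have ur l : represents (power_chain lam) Om z (fun x => u x l 0)
    (noeth_symbol A (a s i) z l 1).
  by apply: represents_noeth_power => x Omx; rewrite uE.
have dpsi := power_chainP R lam.
split; [split => [l|x Omx j] | move=> l].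
- exact: represents_smooth dpsi Om_open Re_lt0 _ _ (ur l).
- rewrite -[RHS](noeth_symbol_annihilates s i z (cvec x) j
    ((power_chain lam)^~ (dotc x z)) Vz).
  apply: eq_bigr => l _; rewrite -xdiff_noeth_symbol.
  exact: (represents_pdiff _ _ _ _ _ _ dpsi Om_open Re_lt0 _ _ (P j l) (ur l) x Omx).
- apply: represents_euler dpsi Om_open Re_lt0 _ _ _ (ur l) _ => x Omx.
  rewrite /noeth_symbol [in RHS]symbol_fun_sum mulr_sumr.
  under eq_bigr do rewrite (xderiv_sum _ _ _) scaler_sumr.
  rewrite exchange_big symbol_fun_sum; apply: eq_bigr => al _ /=.
  under eq_bigr do rewrite xderivZ scalerA mulrC -scalerA.
  rewrite -scaler_sumr /symbol_fun !symbol_evalZ mulrCA; congr (_ * _).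
  by apply: symbol_eval_euler => k; apply: power_chain_euler; exact: Re_lt0.
Qed.

End Family.
End Annihilation.

(** * The cone and its tube *)

Section Tube.
Variables (R : realType) (n : nat).

Lemma ReE_dotc (x : 'rV[R]_n) (z : 'rV[Cx R]_n) :
  complex.Re (dotc x z) = dotr x (rpart z).
Proof.
rewrite /dotc /dotr (big_morph (@complex.Re R) (id1 := 0) (op1 := +%R)) //; last first.
  by move=> [a b] [c e].
by apply: eq_bigr => k _; rewrite mxE; case: (z 0 k) => a b; rewrite /= mul0r subr0.
Qed.

(** An open set around the origin contains [t *: e] and [- t *: e] for small
    [t], which pointedness forbids as soon as there is a nonzero vector [e]. *)
Lemma pointed_open_notin0 (Om : set 'rV[R]_n) :
  (0 < n)%N -> open Om -> pointed_cone Om -> ~ Om 0.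
Proof.
case: n Om => // n' Om _ oO pO O0.
have cl : {for (0 : R), continuous (fun t : R => t *: (delta_mx 0 ord0 : 'rV[R]_n'.+1))}.
  exact: scalel_continuous.
have nO : \forall t \near (0 : R), Om (t *: (delta_mx 0 ord0 : 'rV[R]_n'.+1)).
  by apply: cl; rewrite scale0r; exact: open_nbhs_nbhs.
have /nbhs_normP[e /= e0 eO] := nO.
have e2 : `|e / 2| < e by rewrite gtr0_norm ?divr_gt0 // ltr_pdivrMr // ltr_pMr // ltr1n.
have Op : Om (e / 2 *: delta_mx 0 ord0) by apply: eO; rewrite /= sub0r normrN.
have Om' : Om (- (e / 2) *: delta_mx 0 ord0) by apply: eO; rewrite /= sub0r opprK.
have : (closure Om `&` [set - x | x in closure Om]) (e / 2 *: delta_mx 0 ord0).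
  split; first exact: subset_closure.
  by exists (- (e / 2) *: delta_mx 0 ord0); [exact: subset_closure | rewrite scaleNr opprK].
rewrite pO => /= /matrixP /(_ 0 ord0) /eqP; rewrite !mxE !eqxx mulr1.
by rewrite gt_eqF // divr_gt0.
Qed.

End Tube.

Theorem proposition3p4 (R : realType) (n J L m : nat)
    (hn : (0 < n)%N) (hJ : (0 < J)%N) (hL : (0 < L)%N) (hm : (0 < m)%N)
    (P : 'M[Cpoly R n]_(J, L))
    (hP : forall j l, P j l != 0 -> P j l \is mpoly.ishomog1 m mpoly.mdeg)
    (lam : Cx R) (Om : set 'rV[R]_n)
    (Om_neq0 : Om !=set0) (Om_open : open Om) (Om_cone : is_cone Om)
    (Om_pointed : pointed_cone Om) (Om_convex : convex_set Om)
    (mu : nat) (Ms : 'I_mu -> set 'cV[Cpoly R n]_L)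
    (hMs : primary_decomposition (image_submodule P) Ms)
    (rho : 'I_mu -> nat) (A : nat)
    (a : forall s : 'I_mu, 'I_(rho s) -> noeth_op R n L A)
    (ha : noetherian_operators P Ms a) :
  (forall (s : 'I_mu) (i : 'I_(rho s)) (z : 'rV[Cx R]_n),
     assoc_variety Ms s z -> tube Om z ->
     solutions P Om (noeth_power a lam i z) /\
     forall l, euler_homogeneous lam Om (fun x => noeth_power a lam i z x l 0))
  /\ noeth_power_set Ms a lam Om `<=`
     solutions P Om `&`
     [set u : 'rV[R]_n -> 'cV[Cx R]_L |
        forall l, euler_homogeneous lam Om (fun x => u x l 0)].
Proof.
have P_homog j l be : be \in mpoly.msupp (P j l) -> mpoly.mdeg be = m.
  move=> bep; have P0 : P j l != 0.
    by apply/eqP => P0; rewrite P0 mpoly.msupp0 in bep.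
  by have /allP/(_ _ bep)/eqP := hP _ _ P0.
have Re_lt0 z : tube Om z -> forall x, Om x -> complex.Re (dotc x z) < 0.
  move=> Uz x Omx; rewrite ReE_dotc; apply: Uz; first exact: subset_closure.
  apply/eqP => x0; rewrite x0 in Omx.
  exact: pointed_open_notin0 hn Om_open Om_pointed Omx.
have sol s (i : 'I_(rho s)) z u : assoc_variety Ms s z -> tube Om z ->
    (forall x, Om x -> u x = noeth_power a lam i z x) ->
    solutions P Om u /\ forall l, euler_homogeneous lam Om (fun x => u x l 0).
  move=> Vz Uz.
  exact: (noeth_power_solution _ _ _ _ _ _ P_homog _ _ _ _ _ ha.1 _ _ _
    Om_open (Re_lt0 _ Uz) _ _ _ Vz).
split=> [s i z Vz Uz|u [s [i [z [Vz Uz uE]]]]]; first exact: (sol s i z).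
exact: (sol s i z).
Qed.
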